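(* Let $\gamma$ be a curve in $\mathbb{H}^2$ with constant curvature $\kappa>0$. (1) If $\gamma$ is a hyperbolic circle, then the inverse curve shortening flow with initial condition $\gamma$ is formed by hyperbolic circles sharing the same center as $\gamma$. (2) If $\gamma$ is a horocycle, then the inverse curve shortening flow with initial condition $\gamma$ is formed by horocycles sharing the same ideal boundary point as $\gamma$. (3) If $\gamma$ is an equidistant line, then the inverse curve shortening flow with initial condition $\gamma$ is formed by equidistant lines sharing the same ideal boundary points as $\gamma$. Furthermore, the inverse curve shortening flow of all of the curves above is expanding, while the backward time limits are, respectively, the common center, the ideal boundary point, and a geodesic.
   Context: $\mathbb{H}^2$ is the upper half-plane $\{(x,y)\in\mathbb{R}^2: y>0\}$ with metric $(dx^2+dy^2)/y^2$ and ideal boundary $\{y=0\}\cup\{\infty\}$. A family of curves $\{\gamma_t\colon I\to\mathbb{H}^2,\ t\in J\}$, where $J\subset\mathbb{R}$ is an interval with $0\in J$, evolves by the inverse curve shortening flow with initial condition $\gamma$ if $\left(\frac{\partial\gamma_t}{\partial t}\right)^{\perp}=-\frac{1}{\kappa(t,\cdot)}N(t,\cdot)$ and $\gamma_0=\gamma$, where $\kappa(t,\cdot)$ and $N(t,\cdot)$ are the curvature and unit normal of $\gamma_t$ and $\perp$ denotes the normal component. Here $N=y\,(-y',x')/\sqrt{x'^2+y'^2}$ and $\kappa=y\kappa_e+x'/\sqrt{x'^2+y'^2}$, with $\kappa_e$ the Euclidean curvature. Curves of constant curvature $\kappa>0$: equidistant lines ($0<\kappa<1$; non-geodesic arcs of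 Euclidean circles supported on the line $y=0$, and non-vertical, non-horizontal straight lines), horocycles ($\kappa=1$; Euclidean circles tangent to $y=0$, and horizontal lines), and hyperbolic circles ($\kappa>1$; Euclidean circles contained in the open upper half-plane). Geodesics are vertical lines and half-circles orthogonal to $y=0$. The backward time limit is the limit of $\gamma_t$ as $t$ decreases to the left end of the time interval of existence. Expanding means, for the representatives normalized by an isometry as a hyperbolic circle about $(0,1)$, a Euclidean circle tangent to $y=0$ at $(0,0)$, or a Euclidean circular arc centered at $(0,c)$, $c>0$, meeting $y=0$, that the radius of the evolving curve (hyperbolic radius in the first case, Euclidean radius in the others) increases, tending to $\infty$ as $t\to\infty$. *)

(* Defs.v *)
From Stdlib Require Import Reals.
From Coquelicot Require Import Coquelicot.
Open Scope R_scope.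

Definition plane : Type := (R * R)%type.
Definition pset : Type := plane -> Prop.

Definition same_set (A B : pset) : Prop := forall p, A p <-> B p.
Definition image (f : plane -> plane) (A : pset) : pset :=
  fun q => exists p, A p /\ f p = q.
Definition trace (I : R -> Prop) (c : R -> plane) : pset :=
  fun q => exists s, I s /\ c s = q.

Definition is_interval (I : R -> Prop) : Prop :=
  forall a b x, I a -> I b -> a <= x <= b -> I x.

Definition halfplane : pset := fun p => 0 < snd p.

(** The metric (dx^2 + dy^2) / y^2 at [p]. *)
Definition hmetric (p v w : plane) : R :=
  (fst v * fst w + snd v * snd w) / (snd p) ^ 2.

(** The distance induced by [hmetric], in closed form:
    sinh (d / 2) = |p - q| / (2 sqrt (y_p y_q)). *)
Definition hdist (p q : plane) : R :=
  2 * arcsinh (sqrt ((fst p - fst q) ^ 2 + (snd p - snd q) ^ 2)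
               / (2 * sqrt (snd p * snd q))).

(** Orientation-reversing isometries are included; the values of [f] outside
    the half-plane are irrelevant. *)
Definition is_isometry (f : plane -> plane) : Prop :=
  (forall p, halfplane p -> halfplane (f p)) /\
  (forall p q, halfplane p -> halfplane q -> hdist (f p) (f q) = hdist p q) /\
  (forall q, halfplane q -> exists p, halfplane p /\ f p = q).

Inductive ideal_point : Type :=
  | Ideal : R -> ideal_point      (* the point (b, 0) *)
  | Ideal_infty : ideal_point.

(** Derivative at [s] relative to [I]: one-sided at an end point of [I] that
    belongs to [I], and [is_derive] when [I] is a neighbourhood of [s]. *)
Definition is_derive_in (I : R -> Prop) (f : R -> plane) (s : R) (l : plane)
  : Prop :=
  filterdiff f (within I (locally s)) (fun h : R => scal h l).

(** [c] is a regular curve of class C^2 in the half-plane, with first and second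
    derivatives [c1] and [c2]. *)
Definition regular_curve (I : R -> Prop) (c c1 c2 : R -> plane) : Prop :=
  (forall s, I s ->
     halfplane (c s) /\ c1 s <> (0, 0) /\
     is_derive_in I c s (c1 s) /\ is_derive_in I c1 s (c2 s)) /\
  continuous_on I c2.

Definition enorm (v : plane) : R := sqrt (fst v ^ 2 + snd v ^ 2).

(** In the next three definitions [p], [v], [a] stand for the position and the
    first and second derivatives of a curve at a given parameter. *)
Definition unit_normal (p v : plane) : plane :=
  (snd p * - snd v / enorm v, snd p * fst v / enorm v).

Definition euclidean_curvature (v a : plane) : R :=
  (fst v * snd a - snd v * fst a) / enorm v ^ 3.

Definition curvature (p v a : plane) : R :=
  snd p * euclidean_curvature v a + fst v / enorm v.

Definition has_constant_curvature (I : R -> Prop) (c : R -> plane) (k : R)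
  : Prop :=
  exists c1 c2, regular_curve I c c1 c2 /\
    forall s, I s -> curvature (c s) (c1 s) (c2 s) = k.

Definition ecircle (m : plane) (rho : R) : pset :=
  fun p => (fst p - fst m) ^ 2 + (snd p - snd m) ^ 2 = rho ^ 2.

Definition hyperbolic_circle (p : plane) (r : R) : pset :=
  fun q => halfplane q /\ hdist p q = r.

Definition is_hyperbolic_circle (p : plane) (S : pset) : Prop :=
  exists r, 0 < r /\ same_set S (hyperbolic_circle p r).

Definition is_horocycle (z : ideal_point) (S : pset) : Prop :=
  match z with
  | Ideal b => exists rho, 0 < rho /\
      same_set S (fun p => halfplane p /\ ecircle (b, rho) rho p)
  | Ideal_infty => exists h, 0 < h /\ same_set S (fun p => snd p = h)
  end.

Definition is_equidistant_line (z1 z2 : ideal_point) (S : pset) : Prop :=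
  match z1, z2 with
  | Ideal a, Ideal b => a <> b /\ exists m c rho, c <> 0 /\
      ecircle (m, c) rho (a, 0) /\ ecircle (m, c) rho (b, 0) /\
      same_set S (fun p => halfplane p /\ ecircle (m, c) rho p)
  | Ideal a, Ideal_infty | Ideal_infty, Ideal a => exists k, k <> 0 /\
      same_set S (fun p => halfplane p /\ snd p = k * (fst p - a))
  | Ideal_infty, Ideal_infty => False
  end.

Definition is_geodesic (z1 z2 : ideal_point) (S : pset) : Prop :=
  match z1, z2 with
  | Ideal a, Ideal b => a <> b /\ exists m rho,
      ecircle (m, 0) rho (a, 0) /\ ecircle (m, 0) rho (b, 0) /\
      same_set S (fun p => halfplane p /\ ecircle (m, 0) rho p)
  | Ideal a, Ideal_infty | Ideal_infty, Ideal a =>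
      same_set S (fun p => halfplane p /\ fst p = a)
  | Ideal_infty, Ideal_infty => False
  end.

Definition normal_part (p v w : plane) : plane :=
  scal (hmetric p w (unit_normal p v)) (unit_normal p v).

(** Classical solutions: C^1 in the time [t] and C^2 in the parameter [s], with
    derivatives jointly continuous on [J] x [I].  [gs], [gss], [gt] are the
    partial derivatives of [g : t |-> s |-> g t s]. *)
Definition evolves_by_ICSF (I J : R -> Prop) (c : R -> plane)
  (g : R -> R -> plane) : Prop :=
  is_interval J /\ J 0 /\ (forall s, I s -> g 0 s = c s) /\
  exists gs gss gt : R -> R -> plane,
    (forall t, J t -> regular_curve I (g t) (gs t) (gss t)) /\
    (forall t s, J t -> I s ->
       is_derive_in J (fun t' => g t' s) t (gt t s)) /\
    continuous_on (fun z : R * R => J (fst z) /\ I (snd z))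
      (fun z => gs (fst z) (snd z)) /\
    continuous_on (fun z : R * R => J (fst z) /\ I (snd z))
      (fun z => gss (fst z) (snd z)) /\
    continuous_on (fun z : R * R => J (fst z) /\ I (snd z))
      (fun z => gt (fst z) (snd z)) /\
    (forall t s, J t -> I s ->
       let k := curvature (g t s) (gs t s) (gss t s) in
       k <> 0 /\
       normal_part (g t s) (gs t s) (gt t s)
         = scal (- (1 / k)) (unit_normal (g t s) (gs t s))).

Definition evolves_with_constant_curvature (I J : R -> Prop) (c : R -> plane)
  (g : R -> R -> plane) : Prop :=
  evolves_by_ICSF I J c g /\
  forall t, J t -> exists k, has_constant_curvature I (g t) k.

Definition not_extendable (I J : R -> Prop) (c : R -> plane)
  (g : R -> R -> plane) : Prop :=
  forall (J' : R -> Prop) (g' : R -> R -> plane),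
    evolves_by_ICSF I J' c g' ->
    (forall t, J t -> J' t) ->
    (forall t s, J t -> I s -> g' t s = g t s) ->
    forall t, J' t -> J t.

(** "The" flow issuing from a curve [c] of constant curvature: it cannot be
    extended in time, and every flow from [c] through curves of constant
    curvature lives on a subinterval of [J] and moves inside the curves [g t].
    Equality of the parametrizations cannot be asked for, since the equation only
    prescribes the normal part of the velocity; nor can equality of the traces,
    since for non-compact curves a tangential motion may lose an end. *)
Definition is_the_ICSF (I J : R -> Prop) (c : R -> plane)
  (g : R -> R -> plane) : Prop :=
  evolves_with_constant_curvature I J c g /\
  not_extendable I J c g /\
  forall (J' : R -> Prop) (g' : R -> R -> plane),
    evolves_with_constant_curvature I J' c g' ->
    forall t, J' t -> J t /\ forall s, I s -> trace I (g t) (g' t s).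

Definition normalized_circle (rho : R) (S : pset) : Prop :=
  0 < rho /\ same_set S (hyperbolic_circle (0, 1) rho).

Definition normalized_horocycle (rho : R) (S : pset) : Prop :=
  0 < rho /\ same_set S (fun p => halfplane p /\ ecircle (0, rho) rho p).

Definition normalized_equidistant_line (rho : R) (S : pset) : Prop :=
  exists c, 0 < c < rho /\
    same_set S (fun p => halfplane p /\ ecircle (0, c) rho p).

(** [normalized rho S] says that [S] is a normalized representative of radius
    [rho]; one isometry normalizes the whole family [S]. *)
Definition expanding (normalized : R -> pset -> Prop) (J : R -> Prop)
  (S : R -> pset) : Prop :=
  exists f, is_isometry f /\ exists rho : R -> R,
    (forall t, J t -> normalized (rho t) (image f (S t))) /\
    (forall t1 t2, J t1 -> J t2 -> t1 < t2 -> rho t1 < rho t2) /\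
    is_lim rho p_infty p_infty.

Definition after (T : Rbar) : R -> Prop := fun t => Rbar_lt T t.

(** [t] decreases to [T], the left end of [after T]. *)
Definition backward (T : Rbar) : (R -> Prop) -> Prop :=
  within (after T) (Rbar_locally' T).

(** Hausdorff convergence; meaningful for subsets of the half-plane. *)
Definition converges_to (F : (R -> Prop) -> Prop) (S : R -> pset) (L : pset)
  : Prop :=
  forall eps, 0 < eps -> F (fun t =>
    (forall p, S t p -> exists q, L q /\ hdist p q < eps) /\
    (forall q, L q -> exists p, S t p /\ hdist p q < eps)).

Definition converges_to_ideal (F : (R -> Prop) -> Prop) (S : R -> pset)
  (z : ideal_point) : Prop :=
  match z with
  | Ideal b => forall eps, 0 < eps ->
      F (fun t => forall p, S t p -> enorm (fst p - b, snd p) < eps)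
  | Ideal_infty => forall M : R,
      F (fun t => forall p, S t p -> M < enorm p)
  end.

(* Main.v *)
Require Import Defs.
From Stdlib Require Import Reals Lra Psatz Classical.
From Coquelicot Require Import Coquelicot.
Open Scope R_scope.

(** Every curve of constant curvature [k <> 0] is a level set
    [A (x^2 + y^2) + B x + D = al y], that is, a plane section of the hyperboloid
    model, with [k = al / sqrt (al^2 + B^2 - 4 A D)].  The function
    [F = (A (x^2 + y^2) + B x + D) / y] satisfies [|grad F|^2 = F^2 + B^2 - 4 A D],
    so keeping [A, B, D] fixed the flow reduces to the equation
    [al al' = al^2 + B^2 - 4 A D], and [al^2 + B^2 - 4 A D] grows like [e^(2t)].
    The discriminant [B^2 - 4 A D] is negative for circles, zero for horocycles
    and positive for equidistant lines; only in the last case does [al], hence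
    the curvature, vanish at a finite time, where the flow cannot be continued.
    The points move along the gradient lines of [F], which are given by linear
    combinations with the normal vector of the planes in the hyperboloid model.

    Uniqueness: for a flow through curves of constant curvature [k(t)], the vector
    [nu = (A, B, D) / al] is recovered from three points of the curve and the
    equation forces [nu' = - nu / k^2 = - (1 + b^2 - 4 a d) nu], where
    [nu = (a, b, d)]; hence [nu] keeps its direction. *)

(** * Limits and derivatives relative to a set *)

(** [F] is a linear function restricted to the hyperboloid, so its Hessian is [F] times the metric.
    Hence the curve [F = al] has curvature [al / |grad F|], and [grad F / al] is a normal field of
    length [1 / k] along it. Following this field moves [X] to [exp t X + q n] with an explicit [q],
    which gives existence in closed form for the three types of curve at once. Uniqueness needs no
    theorem on differential equations either: each quantity expected to be conserved has derivative
    zero, hence is constant. The difficulty is regularity. [I] and the competing time intervals may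
    contain end points, and a time interval may even be a single point, so every derivative is taken
    relative to a set; and the tangent of a competing flow is only continuous in time, hence so are,
    a priori, the coefficients of its curves. *)

Definition tends {T : Type} (F : (T -> Prop) -> Prop) (f : T -> R) (l : R) : Prop :=
  filterlim f F (locally l).

Section Tends.
Context {T : Type} {F : (T -> Prop) -> Prop} {FF : Filter F}.

Lemma tends_eps (f : T -> R) (l : R) :
  tends F f l <-> forall eps, 0 < eps -> F (fun x => Rabs (f x - l) < eps).
Proof.
  unfold tends. rewrite filterlim_locally. split.
  - intros H eps Heps. exact (H (mkposreal eps Heps)).
  - intros H eps. exact (H eps (cond_pos eps)).
Qed.

Lemma tends_ext (f g : T -> R) (l : R) :
  F (fun x => f x = g x) -> tends F f l -> tends F g l.
Proof. intros H. apply filterlim_ext_loc, H. Qed.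

Lemma tends_const (a : R) : tends F (fun _ => a) a.
Proof. apply filterlim_const. Qed.

Lemma tends_plus (f g : T -> R) (a b : R) :
  tends F f a -> tends F g b -> tends F (fun x => f x + g x) (a + b).
Proof.
  intros Hf Hg.
  exact (filterlim_comp_2 f g Rplus Hf Hg (@filterlim_plus _ R_NormedModule a b)).
Qed.

Lemma tends_mult (f g : T -> R) (a b : R) :
  tends F f a -> tends F g b -> tends F (fun x => f x * g x) (a * b).
Proof.
  intros Hf Hg.
  exact (filterlim_comp_2 f g Rmult Hf Hg (@filterlim_mult R_AbsRing a b)).
Qed.

Lemma tends_comp (h : R -> R) (f : T -> R) (a : R) :
  continuous h a -> tends F f a -> tends F (fun x => h (f x)) (h a).
Proof. intros Hh Hf. exact (filterlim_comp _ _ _ f h _ _ _ Hf Hh). Qed.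

Lemma tends_opp (f : T -> R) (a : R) :
  tends F f a -> tends F (fun x => - f x) (- a).
Proof. apply (tends_comp Ropp), (@filterlim_opp _ R_NormedModule). Qed.

Lemma tends_minus (f g : T -> R) (a b : R) :
  tends F f a -> tends F g b -> tends F (fun x => f x - g x) (a - b).
Proof. intros Hf Hg. apply tends_plus, tends_opp; assumption. Qed.

Lemma tends_inv (f : T -> R) (a : R) :
  a <> 0 -> tends F f a -> tends F (fun x => / f x) (/ a).
Proof. intros Ha. apply (tends_comp Rinv), continuous_Rinv, Ha. Qed.

Lemma tends_div (f g : T -> R) (a b : R) :
  b <> 0 -> tends F f a -> tends F g b -> tends F (fun x => f x / g x) (a / b).
Proof. intros Hb Hf Hg. apply tends_mult, tends_inv; assumption. Qed.

Lemma tends_pow (f : T -> R) (a : R) (n : nat) :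
  tends F f a -> tends F (fun x => f x ^ n) (a ^ n).
Proof.
  intros Hf. induction n as [|n IH]; simpl;
    [apply tends_const | apply tends_mult; assumption].
Qed.

Lemma tends_sqrt (f : T -> R) (a : R) :
  tends F f a -> tends F (fun x => sqrt (f x)) (sqrt a).
Proof. apply (tends_comp sqrt), continuous_sqrt. Qed.

Lemma tends_pair (f : T -> plane) (p : plane) :
  filterlim f F (locally p) <->
  tends F (fun x => fst (f x)) (fst p) /\ tends F (fun x => snd (f x)) (snd p).
Proof.
  rewrite !tends_eps. split.
  - intros H.
    assert (H' := proj1 (filterlim_locally
      (U := prod_UniformSpace R_UniformSpace R_UniformSpace) f p) H).
    clear H. split; intros eps Heps;
      apply (filter_imp (fun x => ball p (mkposreal eps Heps) (f x))); auto;
      intros x [H1 H2]; assumption.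
  - intros [H1 H2].
    apply (filterlim_locally
      (U := prod_UniformSpace R_UniformSpace R_UniformSpace) f p).
    intros eps. generalize (filter_and _ _ (H1 eps (cond_pos eps)) (H2 eps (cond_pos eps))).
    apply filter_imp. intros x [h1 h2]. split; assumption.
Qed.

End Tends.

Ltac tends_tac :=
  repeat match goal with
  | H : tends ?F ?f ?l |- tends ?F ?f ?l => exact H
  | |- tends _ (fun _ => ?a) _ => exact (tends_const a)
  | |- tends _ (fun x => @?f x + @?g x) _ => refine (tends_plus f g _ _ _ _)
  | |- tends _ (fun x => @?f x - @?g x) _ => refine (tends_minus f g _ _ _ _)
  | |- tends _ (fun x => - @?f x) _ => refine (tends_opp f _ _)
  | |- tends _ (fun x => @?f x * @?g x) _ => refine (tends_mult f g _ _ _ _)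
  | |- tends _ (fun x => @?f x / @?g x) _ => refine (tends_div f g _ _ _ _ _)
  | |- tends _ (fun x => @?f x ^ ?n) _ => refine (tends_pow f _ n _)
  | |- tends _ (fun x => sqrt (@?f x)) _ => refine (tends_sqrt f _ _)
  end.

Lemma within_eps (D : R -> Prop) (s : R) (P : R -> Prop) :
  within D (locally s) P <->
  exists d, 0 < d /\ forall x, D x -> Rabs (x - s) < d -> P x.
Proof.
  split.
  - intros [d Hd]. exists d. split; [apply cond_pos|]. intros x Dx Hx. apply Hd; assumption.
  - intros [d [Hd H]]. exists (mkposreal d Hd). intros x Hx Dx. apply H; assumption.
Qed.

Lemma tends_within_subset (D E : R -> Prop) (s : R) (f : R -> R) (l : R) :
  (forall x, E x -> D x) -> tends (within D (locally s)) f l ->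
  tends (within E (locally s)) f l.
Proof.
  intros HE Hf P HP. specialize (Hf P HP). unfold filtermap, within in *.
  revert Hf. apply filter_imp. auto.
Qed.

Lemma within_self (D : R -> Prop) (s : R) : within D (locally s) D.
Proof. unfold within. apply filter_forall. auto. Qed.

(** Derivative relative to [D] in Caratheodory's form, where the slope [phi] is
    continuous at [s]: the differentiation rules become rules for limits. *)
Definition deriv_within (D : R -> Prop) (f : R -> R) (s l : R) : Prop :=
  exists phi, tends (within D (locally s)) phi l /\
    forall x, D x -> f x = f s + phi x * (x - s).

Lemma deriv_within_eps (D : R -> Prop) (s : R) (f : R -> R) (l : R) :
  deriv_within D f s l <->
  forall eps, 0 < eps -> within D (locally s)
    (fun x => Rabs (f x - f s - (x - s) * l) <= eps * Rabs (x - s)).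
Proof.
  split.
  - intros [phi [Hphi Hf]] eps Heps. rewrite tends_eps in Hphi.
    generalize (filter_and _ _ (Hphi eps Heps) (within_self D s)).
    apply filter_imp. intros x [Hx Dx]. rewrite (Hf x Dx).
    replace (f s + phi x * (x - s) - f s - (x - s) * l)
      with ((phi x - l) * (x - s)) by ring.
    rewrite Rabs_mult. apply Rmult_le_compat_r; [apply Rabs_pos | lra].
  - intros H.
    (* The filter does not exclude [s], so the slope must take the value [l] there. *)
    exists (fun x => if Req_EM_T x s then l else (f x - f s) / (x - s)). split.
    + apply tends_eps. intros eps Heps.
      generalize (H (eps / 2) ltac:(lra)). apply filter_imp. intros x Hx.
      destruct (Req_EM_T x s) as [->|Hne]; [rewrite Rminus_diag, Rabs_R0; exact Heps|].
      assert (Hp : 0 < Rabs (x - s)) by (apply Rabs_pos_lt; lra).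
      apply (Rmult_lt_reg_r (Rabs (x - s))); [exact Hp|]. rewrite <- Rabs_mult.
      replace (((f x - f s) / (x - s) - l) * (x - s))
        with (f x - f s - (x - s) * l) by (field; lra).
      nra.
    + intros x _. destruct (Req_EM_T x s) as [->|Hne]; [ring | field; lra].
Qed.

Lemma is_derive_deriv_within (D : R -> Prop) (s : R) (f : R -> R) (l : R) :
  is_derive f s l -> deriv_within D f s l.
Proof.
  intros [_ H]. apply deriv_within_eps. intros eps Heps.
  generalize (H s (fun P h => h) (mkposreal eps Heps)). unfold within.
  apply filter_imp. intros x Hx _. exact Hx.
Qed.

Section DerivWithin.
Context (D : R -> Prop) (s : R).

Lemma deriv_within_lim (f : R -> R) (l : R) :
  deriv_within D f s l -> tends (within D (locally s)) f (f s).
Proof.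
  intros [phi [Hphi Hf]].
  apply (tends_ext (fun x => f s + phi x * (x - s))).
  - generalize (within_self D s). apply filter_imp. intros x Dx. symmetry. auto.
  - assert (tends (within D (locally s)) (fun x => x) s) 
      by (intros P HP; unfold filtermap, within; apply (filter_imp P); auto).
    assert (K : tends (within D (locally s)) (fun x => f s + phi x * (x - s))
                  (f s + l * (s - s))) by tends_tac.
    replace (f s + l * (s - s)) with (f s) in K by ring. exact K.
Qed.

Lemma deriv_within_ext (f g : R -> R) (l : R) :
  D s -> (forall x, D x -> f x = g x) -> deriv_within D f s l -> deriv_within D g s l.
Proof.
  intros Ds H [phi [Hphi Hf]]. exists phi. split; [exact Hphi|].
  intros x Dx. rewrite <- !H by assumption. auto.
Qed.

Lemma deriv_within_const (a : R) : deriv_within D (fun _ => a) s 0.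
Proof. exists (fun _ => 0). split; [apply tends_const | intros; ring]. Qed.

Lemma deriv_within_plus (f g : R -> R) (a b : R) :
  deriv_within D f s a -> deriv_within D g s b ->
  deriv_within D (fun x => f x + g x) s (a + b).
Proof.
  intros [phi [Hphi Hf]] [psi [Hpsi Hg]]. exists (fun x => phi x + psi x).
  split; [tends_tac|]. intros x Dx. rewrite (Hf x Dx), (Hg x Dx). ring.
Qed.

(** Since [f] vanishes at [s], the slope of the product is the slope of [f] times [g], so continuity
    of [g] is enough. This is what handles coefficients not yet known to be differentiable. *)
Lemma deriv_within_mult_cont (f g : R -> R) (a b : R) :
  f s = 0 -> deriv_within D f s a -> tends (within D (locally s)) g b ->
  deriv_within D (fun x => f x * g x) s (a * b).
Proof.
  intros H0 [phi [Hphi Hf]] Hg. exists (fun x => phi x * g x).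
  split; [tends_tac|]. intros x Dx. rewrite (Hf x Dx), H0. ring.
Qed.

Lemma deriv_within_mult (f g : R -> R) (a b : R) :
  deriv_within D f s a -> deriv_within D g s b ->
  deriv_within D (fun x => f x * g x) s (a * g s + f s * b).
Proof.
  intros Hf Hg. assert (Cf := deriv_within_lim _ _ Hf).
  destruct Hf as [phi [Hphi Hf]], Hg as [psi [Hpsi Hg]].
  exists (fun x => phi x * g s + f x * psi x).
  split; [tends_tac|]. intros x Dx. rewrite (Hg x Dx), (Hf x Dx). ring.
Qed.

Lemma deriv_within_scal (k : R) (f : R -> R) (a : R) :
  deriv_within D f s a -> deriv_within D (fun x => k * f x) s (k * a).
Proof.
  intros Hf. replace (k * a) with (0 * f s + k * a) by ring.
  apply (deriv_within_mult (fun _ => k)); [apply deriv_within_const | exact Hf].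
Qed.

Lemma deriv_within_opp (f : R -> R) (a : R) :
  deriv_within D f s a -> deriv_within D (fun x => - f x) s (- a).
Proof.
  intros [phi [Hphi Hf]]. exists (fun x => - phi x).
  split; [tends_tac|]. intros x Dx. rewrite (Hf x Dx). ring.
Qed.

Lemma deriv_within_minus (f g : R -> R) (a b : R) :
  deriv_within D f s a -> deriv_within D g s b ->
  deriv_within D (fun x => f x - g x) s (a - b).
Proof. intros Hf Hg. apply deriv_within_plus, deriv_within_opp; assumption. Qed.

Lemma deriv_within_comp (h f : R -> R) (a b : R) :
  is_derive h (f s) b -> deriv_within D f s a ->
  deriv_within D (fun x => h (f x)) s (b * a).
Proof.
  intros Hh Hf. assert (Cf := deriv_within_lim _ _ Hf).
  assert (Hd : deriv_within (fun _ => True) h (f s) b)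
    by apply is_derive_deriv_within, Hh.
  destruct Hd as [psi [Hpsi Hh']], Hf as [phi [Hphi Hf]].
  exists (fun x => psi (f x) * phi x). split.
  - apply tends_mult; [|exact Hphi].
    apply (filterlim_comp _ _ _ f psi _ (within (fun _ => True) (locally (f s)))); [|exact Hpsi].
    intros P HP. apply Cf. unfold within in HP. revert HP. apply filter_imp. auto.
  - intros x Dx. rewrite (Hh' (f x) Logic.I), (Hf x Dx) at 1. rewrite (Hf x Dx). ring.
Qed.

Lemma deriv_within_inv (f : R -> R) (a : R) :
  f s <> 0 -> deriv_within D f s a ->
  deriv_within D (fun x => / f x) s (- a / f s ^ 2).
Proof.
  intros H0 Hf. replace (- a / f s ^ 2) with (- / f s ^ 2 * a) by (field; exact H0).
  apply (deriv_within_comp Rinv); [|exact Hf].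
  auto_derive; [exact H0 | field; exact H0].
Qed.

Lemma deriv_within_div (f g : R -> R) (a b : R) :
  g s <> 0 -> deriv_within D f s a -> deriv_within D g s b ->
  deriv_within D (fun x => f x / g x) s ((a * g s - f s * b) / g s ^ 2).
Proof.
  intros H0 Hf Hg.
  replace ((a * g s - f s * b) / g s ^ 2) with (a * / g s + f s * (- b / g s ^ 2))
    by (field; exact H0).
  apply deriv_within_mult; [exact Hf | apply deriv_within_inv; assumption].
Qed.

Lemma deriv_within_sqr (f : R -> R) (a : R) :
  deriv_within D f s a -> deriv_within D (fun x => f x ^ 2) s (2 * f s * a).
Proof.
  intros Hf. apply (deriv_within_comp (fun x => x ^ 2)); [|exact Hf].
  auto_derive; [trivial | ring].
Qed.

Lemma deriv_within_sqrt (f : R -> R) (a : R) :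
  0 < f s -> deriv_within D f s a ->
  deriv_within D (fun x => sqrt (f x)) s (a / (2 * sqrt (f s))).
Proof.
  intros H0 Hf. assert (H := sqrt_lt_R0 _ H0).
  replace (a / (2 * sqrt (f s))) with (/ (2 * sqrt (f s)) * a) by (field; lra).
  apply (deriv_within_comp sqrt); [|exact Hf].
  auto_derive; [exact H0 | field; lra].
Qed.

End DerivWithin.

Ltac deriv_tac :=
  repeat first
    [ eassumption | apply deriv_within_const | apply deriv_within_scal
    | apply deriv_within_plus | apply deriv_within_minus | apply deriv_within_opp
    | apply deriv_within_sqr | apply deriv_within_div | apply deriv_within_mult
    | apply deriv_within_inv | apply deriv_within_sqrt ].

(** The second point [u] excludes the degenerate interval [{s}], on which every number would be a
    derivative at [s]. *)
Lemma within_proper (D : R -> Prop) (s u : R) :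
  is_interval D -> D s -> D u -> u <> s ->
  ProperFilter' (within (fun x => D x /\ x <> s) (locally s)).
Proof.
  intros HD Ds Du Hus. constructor; [|apply within_filter, locally_filter].
  intros H. apply within_eps in H. destruct H as [d [Hd H]].
  (* The fraction of the way from [s] to [u] at which a point of [D] other than [s] is still within
     [d] of [s]. *)
  set (m := Rmin (1 / 2) (d / (2 * Rabs (u - s)))).
  assert (Hp : 0 < Rabs (u - s)) by (apply Rabs_pos_lt; lra).
  assert (Hm : 0 < m <= 1 / 2 /\ m * Rabs (u - s) < d).
  { assert (0 < d / (2 * Rabs (u - s))) by (apply Rdiv_lt_0_compat; lra).
    assert (m <= d / (2 * Rabs (u - s))) by apply Rmin_r.
    repeat split; [apply Rmin_pos; lra | apply Rmin_l |].
    apply Rle_lt_trans with (d / (2 * Rabs (u - s)) * Rabs (u - s));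
      [apply Rmult_le_compat_r; lra | field_simplify; lra]. }
  apply (H (s + m * (u - s))).
  - split; [|nra].
    destruct (Rlt_or_le u s);
      [apply (HD u s) | apply (HD s u)]; try assumption; nra.
  - replace (s + m * (u - s) - s) with (m * (u - s)) by ring.
    rewrite Rabs_mult, (Rabs_pos_eq m); lra.
Qed.

Lemma deriv_within_unique (D : R -> Prop) (s u : R) (f : R -> R) (l l' : R) :
  is_interval D -> D s -> D u -> u <> s ->
  deriv_within D f s l -> deriv_within D f s l' -> l = l'.
Proof.
  intros HD Ds Du Hus [phi [Hphi Hf]] [psi [Hpsi Hf']].
  assert (PF := within_proper D s u HD Ds Du Hus).
  assert (Hle : forall x, D x /\ x <> s -> D x) by tauto.
  apply (@filterlim_locally_unique _ _ R_NormedModule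
           (within (fun x => D x /\ x <> s) (locally s)) _ phi).
  - exact (tends_within_subset _ _ _ _ _ Hle Hphi).
  - apply (tends_ext psi); [|exact (tends_within_subset _ _ _ _ _ Hle Hpsi)].
    unfold within. apply filter_forall. intros y [Dy Hy].
    apply (Rmult_eq_reg_r (y - s)); [|lra].
    assert (h1 := Hf y Dy). assert (h2 := Hf' y Dy). lra.
Qed.

Lemma deriv_within_zero (D : R -> Prop) (f : R -> R) :
  is_interval D -> (forall s, D s -> deriv_within D f s 0) ->
  forall u v, D u -> D v -> f u = f v.
Proof.
  intros HD H.
  assert (W : forall u v, u < v -> D u -> D v -> f u = f v).
  { intros u v Huv Du Dv.
    (* [f] composed with the retraction onto [u, v] is continuous on the whole line *)
    set (r := fun x => Rmax u (Rmin v x)).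
    assert (Hr : forall x, u <= r x <= v).
    { intros x. unfold r. split; [apply Rmax_l|].
      apply Rmax_lub; [lra | apply Rmin_l]. }
    assert (Hr1 : forall x, u <= x <= v -> r x = x).
    { intros x Hx. unfold r. rewrite Rmin_right, Rmax_right; lra. }
    assert (Dr : forall x, D (r x)) by (intros x; apply (HD u v); auto).
    (* Because the derivative is 0, the error bound at [r y] carries over to [y] as soon as [r] does
       not increase distances. *)
    assert (Lr : forall x y, Rabs (r x - r y) <= Rabs (x - y)).
    { intros x y. unfold r, Rmax, Rmin. unfold Rabs.
      repeat destruct Rle_dec; repeat destruct Rcase_abs; lra. }
    destruct (MVT_gen (fun x => f (r x)) u v (fun _ => 0)) as [c [_ Hc]].
    - rewrite Rmin_left, Rmax_right by lra. intros x Hx.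
      split; [apply (@is_linear_scal_l _ R_NormedModule)|].
      intros x' Hx' eps.
      assert (x = x') as <-.
      { apply (@is_filter_lim_locally_unique R_AbsRing R_NormedModule). exact Hx'. }
      assert (h := proj1 (deriv_within_eps D x f 0) (H x ltac:(apply (HD u v); auto; lra))
                         eps (cond_pos eps)).
      apply within_eps in h. destruct h as [d [Hd h]].
      exists (mkposreal d Hd). intros y Hy. 
      assert (Hx1 : r x = x) by (apply Hr1; lra).
      change (Rabs (f (r y) - f (r x) - (y - x) * 0) <= eps * Rabs (y - x)).
      specialize (h (r y) (Dr y)). rewrite Rmult_0_r in *.
      assert (L := Lr y x). rewrite Hx1 in *.
      change (Rabs (y - x) < d) in Hy.
      apply Rle_trans with (1 := h ltac:(lra)).
      apply Rmult_le_compat_l; [left; apply cond_pos | exact L].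
    - intros x _. apply continuity_pt_filterlim. apply filterlim_locally.
      intros eps. change (locally x (fun y => Rabs (f (r y) - f (r x)) < eps)).
      assert (h := deriv_within_lim _ _ _ _ (H (r x) (Dr x))).
      rewrite tends_eps in h. specialize (h eps (cond_pos eps)).
      apply within_eps in h. destruct h as [d [Hd h]].
      exists (mkposreal d Hd). intros y Hy. apply h; [apply Dr|].
      apply Rle_lt_trans with (1 := Lr y x). exact Hy.
    - rewrite !Hr1 in Hc by lra. lra. }
  intros u v Du Dv. destruct (Rtotal_order u v) as [h|[->|h]];
    [auto | reflexivity | symmetry; auto].
Qed.

Lemma deriv_within_filterdiff (D : R -> Prop) (f : R -> R) (s l : R) :
  D s ->
  (deriv_within D f s l <->
   filterdiff f (within D (locally s)) (fun h : R => scal h l)).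
Proof.
  intros Ds. rewrite deriv_within_eps. split.
  - intros H. split; [apply (@is_linear_scal_l _ R_NormedModule)|].
    intros x Hx eps.
    (* [filterdiff] quantifies over all limit points of the filter; as [s] lies in [D], the only one
       is [s]. *)
    assert (x = s) as ->.
    { destruct (Req_dec x s) as [h|h]; [exact h|exfalso].
      assert (Hp : 0 < Rabs (s - x)) by (apply Rabs_pos_lt; lra).
      assert (K : within D (locally s) (fun y => Rabs (y - x) < Rabs (s - x)))
        by (apply Hx; exists (mkposreal _ Hp); auto).
      apply within_eps in K. destruct K as [d [Hd K]]. apply (Rlt_irrefl (Rabs (s - x))).
      apply K; [exact Ds|]. rewrite Rminus_diag, Rabs_R0. exact Hd. }
    exact (H eps (cond_pos eps)).
  - intros [_ H] eps Heps. apply (H s) with (eps := mkposreal eps Heps).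
    intros P HP. unfold within. revert HP. apply filter_imp. auto.
Qed.

Lemma is_derive_in_iff (D : R -> Prop) (f : R -> plane) (s : R) (l : plane) :
  D s ->
  (is_derive_in D f s l <->
   deriv_within D (fun x => fst (f x)) s (fst l) /\
   deriv_within D (fun x => snd (f x)) s (snd l)).
Proof.
  intros Ds. rewrite !deriv_within_filterdiff by exact Ds.
  unfold is_derive_in. split.
  - intros H. split.
    + apply (filterdiff_comp f fst (fun h : R => scal h l) fst H).
      apply filterdiff_linear, is_linear_fst.
    + apply (filterdiff_comp f snd (fun h : R => scal h l) snd H).
      apply filterdiff_linear, is_linear_snd.
  - intros [H1 H2].
    apply filterdiff_ext with (fun x => (fst (f x), snd (f x)));
      [intros x; symmetry; apply surjective_pairing|].
    apply filterdiff_ext_lin with (fun h : R => (scal h (fst l), scal h (snd l)));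
      [|intros h; destruct l; reflexivity].
    apply (filterdiff_comp_2 _ _ pair _ _ pair H1 H2).
    apply filterdiff_ext_lin with (fun t => t); [|intros []; reflexivity].
    apply filterdiff_ext with (fun t => t); [intros []; reflexivity|].
    apply filterdiff_linear, is_linear_id.
Qed.

(** * Level curves *)

Definition level (A B D al : R) : pset := fun z =>
  halfplane z /\ A * (fst z ^ 2 + snd z ^ 2) + B * fst z + D = al * snd z.

Definition discr (A B D : R) : R := B ^ 2 - 4 * A * D.

(** For [A <> 0] this is the equation of a Euclidean circle of radius
    [sqrt (al ^ 2 + discr A B D) / (2 |A|)]; avoiding the division by [A] covers straight lines
    too. *)
Lemma level_grad_sqr (A B D al : R) (z : plane) :
  level A B D al z ->
  (2 * A * fst z + B) ^ 2 + (2 * A * snd z - al) ^ 2 = al ^ 2 + discr A B D.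
Proof.
  intros [_ H]. unfold discr.
  transitivity (4 * A * (A * (fst z ^ 2 + snd z ^ 2) + B * fst z + D)
                + B ^ 2 - 4 * A * D - 4 * A * al * snd z + al ^ 2); [ring|].
  rewrite H. ring.
Qed.

Lemma level_tangent_enorm (A B D al l : R) (z : plane) :
  level A B D al z ->
  enorm (l * - (2 * A * snd z - al), l * (2 * A * fst z + B))
    = Rabs l * sqrt (al ^ 2 + discr A B D).
Proof.
  intros Hz. unfold enorm; cbn [fst snd].
  rewrite <- sqrt_Rsqr_abs, <- sqrt_mult_alt by apply Rle_0_sqr. f_equal.
  rewrite <- (level_grad_sqr _ _ _ _ _ Hz). unfold Rsqr. ring.
Qed.

(** The tangent [v] is [l] times the rotated gradient, and the condition on [a] is the equation of
    the curve differentiated twice. The sign [l / Rabs l] records the direction of travel. *)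
Lemma level_curvature (A B D al l : R) (z v a : plane) :
  level A B D al z -> 0 < al ^ 2 + discr A B D -> l <> 0 ->
  v = (l * - (2 * A * snd z - al), l * (2 * A * fst z + B)) ->
  2 * A * (fst v ^ 2 + snd v ^ 2) + (2 * A * fst z + B) * fst a
    + (2 * A * snd z - al) * snd a = 0 ->
  curvature z v a = l / Rabs l * (al / sqrt (al ^ 2 + discr A B D)).
Proof.
  intros Hz HW Hl Hv Ha.
  assert (HG := level_grad_sqr _ _ _ _ _ Hz).
  unfold curvature, euclidean_curvature.
  assert (Ev := level_tangent_enorm _ _ _ _ l _ Hz). rewrite <- Hv in Ev. rewrite Ev.
  clear Ev.
  rewrite Hv in *. clear Hv v. cbn [fst snd] in *.
  set (W := sqrt (al ^ 2 + discr A B D)) in *.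
  assert (HWp : 0 < W) by (apply sqrt_lt_R0, HW).
  assert (HW2 : W ^ 2 = al ^ 2 + discr A B D)
    by (rewrite <- Rsqr_pow2; apply Rsqr_sqrt; lra).
  rewrite <- HW2 in HG. clearbody W.
  assert (Hp : 0 < Rabs l) by (apply Rabs_pos_lt, Hl).
  assert (Hl2 : Rabs l ^ 2 = l ^ 2) by apply pow2_abs.
  set (fx := 2 * A * fst z + B) in *. set (fy := 2 * A * snd z - al) in *.
  assert (E : fx * fst a + fy * snd a = - (2 * A * (Rabs l ^ 2 * W ^ 2)))
    by (rewrite Hl2, <- HG; lra).
  replace (l * - fy * snd a - l * fx * fst a) with (- l * (fx * fst a + fy * snd a)) by ring.
  rewrite E. unfold fy. field. lra.
Qed.

(** [w] is the hyperbolic gradient of [F] divided by [al], so it is normal already and has length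
    [sqrt (al ^ 2 + discr A B D) / al]. The unit normal of [v] points against the gradient, whence
    the minus sign. *)
Lemma level_normal_part (A B D al l : R) (z v w : plane) :
  level A B D al z -> 0 < al -> 0 < al ^ 2 + discr A B D -> 0 < l ->
  v = (l * - (2 * A * snd z - al), l * (2 * A * fst z + B)) ->
  w = (snd z * (2 * A * fst z + B) / al, snd z * (2 * A * snd z - al) / al) ->
  normal_part z v w
    = scal (- (1 / (al / sqrt (al ^ 2 + discr A B D)))) (unit_normal z v).
Proof.
  intros Hz Hal HW Hl Hv Hw. unfold normal_part. f_equal.
  assert (HG := level_grad_sqr _ _ _ _ _ Hz).
  assert (Hy : 0 < snd z) by apply Hz.
  assert (Ev := level_tangent_enorm _ _ _ _ l _ Hz). rewrite <- Hv in Ev.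
  unfold unit_normal, hmetric.
  rewrite Ev, (Rabs_pos_eq l), Hv, Hw by lra. clear Ev. cbn [fst snd].
  set (W := sqrt (al ^ 2 + discr A B D)) in *.
  assert (HWp : 0 < W) by (apply sqrt_lt_R0, HW).
  assert (HW2 : W ^ 2 = al ^ 2 + discr A B D)
    by (rewrite <- Rsqr_pow2; apply Rsqr_sqrt; lra).
  rewrite <- HW2 in HG. clearbody W.
  set (fx := 2 * A * fst z + B) in *. set (fy := 2 * A * snd z - al) in *.
  clearbody fx fy.
  transitivity (- (fx ^ 2 + fy ^ 2) / (al * W)); [|rewrite HG]; field; lra.
Qed.

(** In the hyperboloid model [slide] is [X |-> p X + q n], where [n] is the
    normal vector of the planes cutting out the curves [level A B D al]; the
    hyperboloid point with coordinates [(x, y)] is [(1, x, x^2 + y^2) / y]. *)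
Definition slide_q (a1 a2 p : R) : R := (1 - p ^ 2) / (a2 + p * a1).

Definition slide_den (A a1 a2 p : R) (z : plane) : R :=
  p + 2 * slide_q a1 a2 p * A * snd z.

Definition slide (A B a1 a2 p : R) (z : plane) : plane :=
  ((p * fst z - slide_q a1 a2 p * B * snd z) / slide_den A a1 a2 p z,
   snd z / slide_den A a1 a2 p z).

(** The last clause makes [p] the ratio of the lengths of [grad F] on the two levels. Level 0 is
    allowed at one end, so that the geodesic can be reached; [a2 + p * a1] is the denominator of
    [slide_q]. *)
Definition slidable (A B D a1 a2 p : R) : Prop :=
  0 < p /\ 0 <= a1 /\ 0 <= a2 /\ 0 < a2 + p * a1 /\
  p ^ 2 * (a1 ^ 2 + discr A B D) = a2 ^ 2 + discr A B D.

Lemma slidable_inv (A B D a1 a2 p : R) :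
  slidable A B D a1 a2 p -> slidable A B D a2 a1 (/ p).
Proof.
  intros (Hp & H1 & H2 & H3 & H4).
  assert (0 < / p) by (apply Rinv_0_lt_compat, Hp). repeat split; try assumption.
  - replace (a1 + / p * a2) with (/ p * (a2 + p * a1)) by (field; lra).
    apply Rmult_lt_0_compat; assumption.
  - rewrite <- H4. field. lra.
Qed.

Section Slide.
Context (A B D a1 a2 p : R) (Hs : slidable A B D a1 a2 p).
Let q := slide_q a1 a2 p.

Lemma slide_q_eq : q * (a2 + p * a1) = 1 - p ^ 2.
Proof. unfold q, slide_q. field. destruct Hs as (_ & _ & _ & H & _). lra. Qed.

(** With [n = (2 A, - B, 2 D)] one has [F(n) = - discr A B D], so the right-hand side is
    [F(p X + q n)]. Solving for [q] and rationalizing gives the definition of [slide_q], which keeps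
    its meaning when the discriminant is 0. *)
Lemma slide_q_level : a2 = p * a1 - q * discr A B D.
Proof.
  destruct Hs as (Hp & H1 & H2 & H3 & H4).
  apply (Rmult_eq_reg_r (a2 + p * a1)); [|lra].
  replace ((p * a1 - q * discr A B D) * (a2 + p * a1))
    with (p * a1 * (a2 + p * a1) - discr A B D * (q * (a2 + p * a1))) by ring.
  rewrite slide_q_eq. lra.
Qed.

(** The normalization that keeps [p X + q n] on the hyperboloid. *)
Lemma slide_q_norm : p ^ 2 + 2 * p * q * a1 - discr A B D * q ^ 2 = 1.
Proof. assert (h1 := slide_q_eq). assert (h2 := slide_q_level). nra. Qed.

(** [p + q * a1] is the hyperbolic cosine of the distance travelled, as [slide_den_sum] and
    [slide_dist] show. It depends on the two levels only, so all points move equally far. *)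
Lemma slide_q_cosh : p + q * a1 = (p * a2 + a1) / (a2 + p * a1).
Proof. unfold q, slide_q. field. destruct Hs as (_ & _ & _ & H & _). lra. Qed.

Context (z : plane) (Hz : level A B D a1 z).
Let d := slide_den A a1 a2 p z.
Let m := p * fst z - q * B * snd z.
Let e := p * (fst z ^ 2 + snd z ^ 2) + 2 * q * D * snd z.

(** [d], [m], [e], divided by [snd z], are the coordinates of [p X + q n], and this is the equation
    [X1 X3 - X2^2 = 1] of the hyperboloid. *)
Lemma slide_den_mult : d * e = snd z ^ 2 + m ^ 2.
Proof.
  destruct Hz as [_ H]. assert (N := slide_q_norm).
  unfold d, e, m, slide_den. fold q. unfold discr in N.
  apply Rminus_diag_uniq.
  transitivity (2 * p * q * snd z * (A * (fst z ^ 2 + snd z ^ 2) + B * fst z + D - a1 * snd z)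
    + snd z ^ 2 * (p ^ 2 + 2 * p * q * a1 - (B ^ 2 - 4 * A * D) * q ^ 2 - 1)); [ring|].
  rewrite N, H. ring.
Qed.

(** Up to the factor [snd z ^ 2], the left-hand side is the Lorentz product of the point and its
    image. *)
Lemma slide_den_sum :
  d * (fst z ^ 2 + snd z ^ 2) + e - 2 * fst z * m = 2 * (p + q * a1) * snd z ^ 2.
Proof.
  destruct Hz as [_ H]. unfold d, e, m, slide_den. fold q.
  transitivity (2 * p * snd z ^ 2
    + 2 * q * snd z * (A * (fst z ^ 2 + snd z ^ 2) + B * fst z + D)); [ring|].
  rewrite H. ring.
Qed.

(** The image stays on the upper sheet: its Lorentz product with the starting point is positive,
    whereas points on opposite sheets have a negative one. *)
Lemma slide_den_pos : 0 < d.
Proof.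
  assert (Hy : 0 < snd z) by apply Hz.
  assert (M := slide_den_mult). assert (S := slide_den_sum).
  assert (C : 0 < p + q * a1).
  { rewrite slide_q_cosh. destruct Hs as (Hp & H1 & H2 & H3 & H4).
    apply Rdiv_lt_0_compat; [|exact H3].
    assert (0 <= p * a2) by (apply Rmult_le_pos; lra).
    destruct H1 as [h| <-]; [lra|].
    assert (0 < p * a2) by (apply Rmult_lt_0_compat; lra). lra. }
  assert (Hd0 : d <> 0) by (intros h; rewrite h in M; nra).
  destruct (Rlt_or_le 0 d) as [h|h]; [exact h|exfalso].
  (* The product of [d] with the positive left-hand side of [slide_den_sum] is a sum of squares, by
     [slide_den_mult]; so [d] cannot be negative. *)
  assert (K : 0 <= d * (d * (fst z ^ 2 + snd z ^ 2) + e - 2 * fst z * m)).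
  { replace (d * (d * (fst z ^ 2 + snd z ^ 2) + e - 2 * fst z * m))
      with ((d * fst z - m) ^ 2 + (d * snd z) ^ 2 + (d * e - m ^ 2)) by ring.
    rewrite M. assert (H1 := pow2_ge_0 (d * fst z - m)).
    assert (H2 := pow2_ge_0 (d * snd z)). assert (H3 := pow2_ge_0 (snd z)). lra. }
  rewrite S in K.
  assert (0 < 2 * (p + q * a1) * snd z ^ 2) by (apply Rmult_lt_0_compat; nra).
  nra.
Qed.

Lemma slide_level : level A B D a2 (slide A B a1 a2 p z).
Proof.
  assert (Hd := slide_den_pos). assert (M := slide_den_mult). destruct Hz as [Hy H].
  split; unfold halfplane, slide; cbn [fst snd]; fold q d m.
  - apply Rdiv_lt_0_compat; assumption.
  - apply (Rmult_eq_reg_r (d ^ 2)); [|nra].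
    transitivity (A * (snd z ^ 2 + m ^ 2) + B * m * d + D * d ^ 2); [field; lra|].
    rewrite <- M. transitivity (a2 * snd z * d); [|field; lra].
    transitivity (d * (A * e + B * m + D * d)); [ring|].
    rewrite slide_q_level. unfold e, m, d, slide_den, discr. fold q.
    transitivity ((p + 2 * q * A * snd z)
      * (p * (A * (fst z ^ 2 + snd z ^ 2) + B * fst z + D)
         - q * (B ^ 2 - 4 * A * D) * snd z)); [ring|].
    rewrite H. ring.
Qed.

Lemma slide_dist :
  (fst z - fst (slide A B a1 a2 p z)) ^ 2 + (snd z - snd (slide A B a1 a2 p z)) ^ 2
  = 2 * ((p * a2 + a1) / (a2 + p * a1) - 1) * (snd z * snd (slide A B a1 a2 p z)).
Proof.
  assert (Hd := slide_den_pos). assert (M := slide_den_mult). assert (S := slide_den_sum).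
  rewrite <- slide_q_cosh. unfold slide; cbn [fst snd]; fold q d m.
  apply (Rmult_eq_reg_r (d ^ 2)); [|nra].
  transitivity (d * (2 * (p + q * a1) * snd z ^ 2) - 2 * d * snd z ^ 2); [|field; lra].
  rewrite <- S.
  transitivity (d ^ 2 * (fst z ^ 2 + snd z ^ 2) + (snd z ^ 2 + m ^ 2) - 2 * fst z * m * d
                - 2 * d * snd z ^ 2); [field; lra|].
  rewrite <- M. ring.
Qed.

(** With the levels exchanged and [p] inverted, [slide_q] becomes [- q / p], which solves
    [Y = p X + q n] for [X]. *)
Lemma slide_inv : slide A B a2 a1 (/ p) (slide A B a1 a2 p z) = z.
Proof.
  assert (Hd := slide_den_pos). destruct Hs as (Hp & H1 & H2 & H3 & H4).
  assert (Hq : slide_q a2 a1 (/ p) = - q / p).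
  { unfold q, slide_q. field. repeat split; nra. }
  unfold slide, slide_den. rewrite Hq. cbn [fst snd]. fold q.
  change (p + 2 * q * A * snd z) with d. fold m.
  assert (Ed : / p + 2 * (- q / p) * A * (snd z / d) = / d).
  { apply (Rmult_eq_reg_r (p * d)); [|nra].
    transitivity (d - 2 * q * A * snd z); [field; lra|].
    transitivity p; [unfold d, slide_den; fold q; ring | field; lra]. }
  rewrite Ed. destruct z as [x y]; cbn [fst snd] in *. f_equal; [|field; lra].
  unfold m. field. lra.
Qed.

End Slide.

(** * Existence of the flow *)

Lemma deriv_within_conv (D : R -> Prop) (f : R -> R) (s l l' : R) :
  deriv_within D f s l -> l = l' -> deriv_within D f s l'.
Proof. intros H <-. exact H. Qed.

Lemma regular_curve_coords (I : R -> Prop) (c c1 c2 : R -> plane) (s : R) :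
  regular_curve I c c1 c2 -> I s ->
  deriv_within I (fun x => fst (c x)) s (fst (c1 s)) /\
  deriv_within I (fun x => snd (c x)) s (snd (c1 s)) /\
  deriv_within I (fun x => fst (c1 x)) s (fst (c2 s)) /\
  deriv_within I (fun x => snd (c1 x)) s (snd (c2 s)).
Proof.
  intros [H _] Is. destruct (H s Is) as (_ & _ & h1 & h2).
  apply is_derive_in_iff in h1; [|exact Is]. apply is_derive_in_iff in h2; [|exact Is]. tauto.
Qed.

Lemma level_curve_derivatives (A B D al : R) (I : R -> Prop) (c c1 c2 : R -> plane) (s u : R) :
  is_interval I -> regular_curve I c c1 c2 ->
  (forall x, I x -> level A B D al (c x)) -> I s -> I u -> u <> s ->
  (2 * A * fst (c s) + B) * fst (c1 s) + (2 * A * snd (c s) - al) * snd (c1 s) = 0 /\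
  2 * A * (fst (c1 s) ^ 2 + snd (c1 s) ^ 2) + (2 * A * fst (c s) + B) * fst (c2 s)
    + (2 * A * snd (c s) - al) * snd (c2 s) = 0.
Proof.
  intros HI Hc HL Is Iu Hus.
  assert (W : exists v, I v /\ v <> s) by eauto. clear u Iu Hus. 
  (* The first-order identity is proved on all of [I] because it is then differentiated itself. *)
  assert (T1 : forall x, I x -> (2 * A * fst (c x) + B) * fst (c1 x)
                           + (2 * A * snd (c x) - al) * snd (c1 x) = 0).
  { intros x Ix. destruct (regular_curve_coords _ _ _ _ x Hc Ix) as (h1 & h2 & _ & _).
    assert (exists v, I v /\ v <> x) as [v [Iv Hv]].
    { destruct W as [v [Iv Hv]]. destruct (Req_dec s x) as [<-|h]; eauto. }
    apply (deriv_within_unique I x v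
      (fun x => A * (fst (c x) ^ 2 + snd (c x) ^ 2) + B * fst (c x) + D - al * snd (c x)));
      try assumption.
    - eapply deriv_within_conv; [deriv_tac | cbv beta; ring].
    - apply (deriv_within_ext _ _ (fun _ => 0)); [exact Ix | | apply deriv_within_const].
      intros y Iy. destruct (HL y Iy) as [_ E]. lra. }
  split; [exact (T1 s Is)|].
  destruct (regular_curve_coords _ _ _ _ s Hc Is) as (h1 & h2 & h3 & h4).
  destruct W as [v [Iv Hv]].
  apply (deriv_within_unique I s v
    (fun x => (2 * A * fst (c x) + B) * fst (c1 x) + (2 * A * snd (c x) - al) * snd (c1 x)));
    try assumption.
  - eapply deriv_within_conv; [deriv_tac | cbv beta; ring].
  - apply (deriv_within_ext _ _ (fun _ => 0)); [exact Is | | apply deriv_within_const].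
    intros y Iy. symmetry. auto.
Qed.

(** Orthogonality to the gradient determines the tangent up to a factor [l]; a negative [l] would
    make the curvature negative by [level_curvature]. *)
Lemma level_tangent_of_curvature (A B D al k : R) (I : R -> Prop) (c c1 c2 : R -> plane)
  (s u : R) :
  is_interval I -> regular_curve I c c1 c2 ->
  (forall x, I x -> level A B D al (c x)) -> I s -> I u -> u <> s ->
  0 < al -> 0 < al ^ 2 + discr A B D -> 0 < k -> curvature (c s) (c1 s) (c2 s) = k ->
  exists l, 0 < l /\
    c1 s = (l * - (2 * A * snd (c s) - al), l * (2 * A * fst (c s) + B)).
Proof.
  intros HI Hc HL Is Iu Hus Hal HW Hk Hcurv.
  destruct (level_curve_derivatives A B D al I c c1 c2 s u) as [h1 h2]; try assumption.
  assert (HG := level_grad_sqr _ _ _ _ _ (HL s Is)).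
  set (fx := 2 * A * fst (c s) + B) in *. set (fy := 2 * A * snd (c s) - al) in *.
  set (l := (fx * snd (c1 s) - fy * fst (c1 s)) / (al ^ 2 + discr A B D)).
  assert (E : c1 s = (l * - fy, l * fx)).
  { rewrite (surjective_pairing (c1 s)). unfold l. rewrite <- HG in *. f_equal.
    - apply (Rmult_eq_reg_r (fx ^ 2 + fy ^ 2)); [|lra].
      transitivity (- fy * (fx * snd (c1 s) - fy * fst (c1 s))
        + fx * (fx * fst (c1 s) + fy * snd (c1 s))); [ring|].
      rewrite h1. field. lra.
    - apply (Rmult_eq_reg_r (fx ^ 2 + fy ^ 2)); [|lra].
      transitivity (fx * (fx * snd (c1 s) - fy * fst (c1 s))
        + fy * (fx * fst (c1 s) + fy * snd (c1 s))); [ring|].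
      rewrite h1. field. lra. }
  exists l. split; [|exact E].
  assert (l <> 0).
  { intros h. destruct Hc as [Hc _]. destruct (Hc s Is) as (_ & N & _). apply N.
    rewrite E, h. f_equal; ring. }
  assert (K := level_curvature A B D al l (c s) (c1 s) (c2 s) (HL s Is) HW H E h2).
  rewrite Hcurv in K.
  destruct (Rtotal_order l 0) as [h|[h|h]]; [exfalso | contradiction | exact h].
  rewrite Rabs_left in K by exact h.
  assert (0 < al / sqrt (al ^ 2 + discr A B D))
    by (apply Rdiv_lt_0_compat; [exact Hal | apply sqrt_lt_R0, HW]).
  replace (l / - l) with (-1) in K by (field; lra). lra.
Qed.

(** The solution of [al' = (al^2 + dl) / al] with [al(0) = a0]. *)
Definition alpha (a0 dl t : R) : R := sqrt ((a0 ^ 2 + dl) * exp (2 * t) - dl).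

(** Strict positivity of the radicand of [alpha]: the time at which the curvature would vanish is
    left out. *)
Definition flow_time (a0 dl t : R) : Prop := dl < (a0 ^ 2 + dl) * exp (2 * t).

Lemma exp_double (t : R) : exp (2 * t) = exp t ^ 2.
Proof. simpl. rewrite Rmult_1_r, <- exp_plus. f_equal. ring. Qed.

Lemma alpha_pos (a0 dl t : R) : flow_time a0 dl t -> 0 < alpha a0 dl t.
Proof. intros Ht. apply sqrt_lt_R0. unfold flow_time in Ht. lra. Qed.

Lemma alpha_sqr (a0 dl t : R) : flow_time a0 dl t ->
  alpha a0 dl t ^ 2 = (a0 ^ 2 + dl) * exp t ^ 2 - dl.
Proof.
  intros Ht. unfold alpha. rewrite <- Rsqr_pow2, exp_double. apply Rsqr_sqrt.
  unfold flow_time in Ht. rewrite exp_double in Ht. lra.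
Qed.

Lemma alpha_derive (a0 dl : R) (J : R -> Prop) (t : R) :
  flow_time a0 dl t -> deriv_within J (alpha a0 dl) t ((alpha a0 dl t ^ 2 + dl) / alpha a0 dl t).
Proof.
  intros Ht. assert (h := alpha_pos a0 dl t Ht).
  assert (deriv_within J (fun t => exp (2 * t)) t (2 * exp (2 * t)))
    by (apply is_derive_deriv_within; auto_derive; [trivial | ring]).
  rewrite alpha_sqr by exact Ht. unfold flow_time in Ht. unfold alpha in *.
  eapply deriv_within_conv; [deriv_tac; lra|]. cbv beta. rewrite exp_double in *.
  field. lra.
Qed.

Lemma alpha_0 (a0 dl : R) : 0 <= a0 -> alpha a0 dl 0 = a0.
Proof.
  intros H. unfold alpha. rewrite Rmult_0_r, exp_0.
  replace ((a0 ^ 2 + dl) * 1 - dl) with (a0 ^ 2) by ring. apply sqrt_pow2, H.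
Qed.

(** The factor [exp t] is dictated by [slidable], since [alpha ^ 2 + discr] grows by the factor
    [exp (2 * t)]. *)
Definition icsf (A B D a0 : R) (c : R -> plane) (t s : R) : plane :=
  slide A B a0 (alpha a0 (discr A B D) t) (exp t) (c s).

(** Identifies derivatives supplied by different existential witnesses for the same curve. *)
Lemma regular_curve_unique (I : R -> Prop) (c c1 c2 d d1 d2 : R -> plane) (s0 s1 : R) :
  is_interval I -> I s0 -> I s1 -> s0 <> s1 ->
  regular_curve I c c1 c2 -> regular_curve I d d1 d2 ->
  (forall s, I s -> c s = d s) ->
  forall s, I s -> c1 s = d1 s /\ c2 s = d2 s.
Proof.
  intros HI Is0 Is1 Hs01 Hc Hd E.
  assert (W : forall s, I s -> exists u, I u /\ u <> s).
  { intros s Is. destruct (Req_dec s0 s) as [<-|h0]; eauto. }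
  assert (E1 : forall s, I s -> c1 s = d1 s).
  { intros s Is. destruct (W s Is) as [u [Iu Hu]].
    destruct (regular_curve_coords _ _ _ _ s Hc Is) as (h1 & h2 & _ & _).
    destruct (regular_curve_coords _ _ _ _ s Hd Is) as (k1 & k2 & _ & _).
    apply injective_projections.
    - apply (deriv_within_unique I s u (fun x => fst (c x))); try assumption.
      apply (deriv_within_ext _ _ (fun x => fst (d x))); auto.
      intros x Ix. rewrite E; auto.
    - apply (deriv_within_unique I s u (fun x => snd (c x))); try assumption.
      apply (deriv_within_ext _ _ (fun x => snd (d x))); auto.
      intros x Ix. rewrite E; auto. }
  intros s Is. split; [auto|]. destruct (W s Is) as [u [Iu Hu]].
  destruct (regular_curve_coords _ _ _ _ s Hc Is) as (_ & _ & h1 & h2).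
  destruct (regular_curve_coords _ _ _ _ s Hd Is) as (_ & _ & k1 & k2).
  apply injective_projections.
  - apply (deriv_within_unique I s u (fun x => fst (c1 x))); try assumption.
    apply (deriv_within_ext _ _ (fun x => fst (d1 x))); auto.
    intros x Ix. rewrite E1; auto.
  - apply (deriv_within_unique I s u (fun x => snd (c1 x))); try assumption.
    apply (deriv_within_ext _ _ (fun x => snd (d1 x))); auto.
    intros x Ix. rewrite E1; auto.
Qed.

Lemma enorm_pos (v : plane) : v <> (0, 0) -> 0 < enorm v.
Proof.
  intros Hv. apply sqrt_lt_R0. destruct v as [a b]. cbn [fst snd].
  destruct (Req_dec a 0) as [->|Ha]; [|nra].
  destruct (Req_dec b 0) as [->|Hb]; [contradiction Hv; reflexivity | nra].
Qed.

Lemma tends_enorm {T : Type} {F : (T -> Prop) -> Prop} {FF : Filter F}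
  (f : T -> plane) (v : plane) :
  filterlim f F (locally v) -> tends F (fun x => enorm (f x)) (enorm v).
Proof. intros H. apply tends_pair in H. destruct H. unfold enorm. tends_tac. Qed.

Lemma tends_curvature {T : Type} {F : (T -> Prop) -> Prop} {FF : Filter F}
  (f f1 f2 : T -> plane) (p v a : plane) :
  v <> (0, 0) ->
  filterlim f F (locally p) -> filterlim f1 F (locally v) -> filterlim f2 F (locally a) ->
  tends F (fun x => curvature (f x) (f1 x) (f2 x)) (curvature p v a).
Proof.
  intros Hv Hp Hv1 Ha. assert (He := enorm_pos v Hv). assert (T1 := tends_enorm _ _ Hv1).
  apply tends_pair in Hp, Hv1, Ha. destruct Hp, Hv1, Ha.
  unfold curvature, euclidean_curvature.
  assert (enorm v ^ 3 <> 0) by (apply pow_nonzero; lra).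
  tends_tac; lra.
Qed.

Lemma continuous_on_slice (I J : R -> Prop) (G : R -> R -> plane) (t s : R) :
  continuous_on (fun z : R * R => J (fst z) /\ I (snd z)) (fun z => G (fst z) (snd z)) ->
  J t -> I s ->
  filterlim (fun t' => G t' s) (within J (locally t)) (locally (G t s)).
Proof.
  intros H Jt Is.
  apply (filterlim_comp _ _ _ (fun x => (x, s)) (fun z => G (fst z) (snd z)) _ _ _)
    with (2 := H (t, s) (conj Jt Is)).
  intros P [d HP]. exists d. intros x Hx Jx. apply HP; [|split; assumption].
  split; [exact Hx | apply ball_center].
Qed.

Lemma is_derive_in_continuous (D : R -> Prop) (f : R -> plane) (t : R) (l : plane) :
  D t -> is_derive_in D f t l -> filterlim f (within D (locally t)) (locally (f t)).
Proof.
  intros Dt H. apply is_derive_in_iff in H; [|exact Dt]. destruct H as [H1 H2].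
  apply tends_pair. split; eapply deriv_within_lim; eassumption.
Qed.

Section Existence.
Context (A B D a0 : R) (Ha0 : 0 < a0) (HW0 : 0 < a0 ^ 2 + discr A B D).
Let dl := discr A B D.
Let al := alpha a0 dl.
Let q (t : R) := slide_q a0 (al t) (exp t).

Lemma icsf_slidable (t : R) : flow_time a0 dl t -> slidable A B D a0 (al t) (exp t).
Proof.
  intros Ht. assert (h : 0 < al t) by exact (alpha_pos a0 dl t Ht). assert (he := exp_pos t).
  repeat split; try lra; [nra|]. unfold al; rewrite alpha_sqr by exact Ht. fold dl. ring.
Qed.

(** This rate makes the velocity of [Y = exp t X + q n] equal to [Y - n / al], which is
    [grad F / al] in the hyperboloid model. *)
Lemma slide_q_derive (J : R -> Prop) (t : R) :
  flow_time a0 dl t -> deriv_within J q t (q t - 1 / al t).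
Proof.
  intros Ht. assert (h : 0 < al t) by exact (alpha_pos a0 dl t Ht). assert (he := exp_pos t).
  assert (Hal : deriv_within J al t ((al t ^ 2 + dl) / al t))
    by exact (alpha_derive a0 dl J t Ht).
  assert (Hexp : deriv_within J exp t (exp t))
    by (apply is_derive_deriv_within; auto_derive; [trivial | ring]).
  assert (Hp : 0 < exp t * a0) by (apply Rmult_lt_0_compat; lra).
  unfold q, slide_q.
  eapply deriv_within_conv; [deriv_tac; lra|]. cbv beta.
  assert (E : al t ^ 2 = (a0 ^ 2 + dl) * exp t ^ 2 - dl) by exact (alpha_sqr a0 dl t Ht).
  set (a := al t) in *. set (p := exp t) in *.
  clearbody a p dl. 
  (* Once denominators are cleared, the identity is polynomial and follows from
     [p ^ 2 * (a0 ^ 2 + dl) = a ^ 2 + dl]. *)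
  apply (Rmult_eq_reg_r (a * (a + p * a0) ^ 2)); [|apply Rgt_not_eq; apply Rmult_lt_0_compat; nra].
  field_simplify; [|lra|lra]. 
  assert (E' : (1 - p ^ 2) * dl = p ^ 2 * a0 ^ 2 - a ^ 2) by lra. nra.
Qed.

Section Curve.
Context (I : R -> Prop) (c c1 c2 : R -> plane) (s0 s1 kappa : R)
  (HI : is_interval I) (Is0 : I s0) (Is1 : I s1) (Hs01 : s0 <> s1)
  (Hc : regular_curve I c c1 c2) (Hkappa : 0 < kappa)
  (Hcurv : forall s, I s -> curvature (c s) (c1 s) (c2 s) = kappa)
  (HL : forall s, I s -> level A B D a0 (c s)).

Let g := icsf A B D a0 c.
Let den t s := slide_den A a0 (al t) (exp t) (c s).
(** The numerator left by the quotient rule for [slide], divided by [exp t]: the terms quadratic in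
    [q] cancel. It is linear in [v] and its last term contributes nothing further when
    differentiated along the curve, so the second derivative uses it again with [c2]. *)
Let h v t s := exp t * fst v - q t * B * snd v
  + 2 * q t * A * (fst v * snd (c s) - fst (c s) * snd v).
Let gs (t s : R) : plane :=
  (exp t * h (c1 s) t s / den t s ^ 2, exp t * snd (c1 s) / den t s ^ 2).
Let gss (t s : R) : plane :=
  (exp t * h (c2 s) t s / den t s ^ 2
     - 4 * exp t * q t * A * snd (c1 s) * h (c1 s) t s / den t s ^ 3,
   exp t * snd (c2 s) / den t s ^ 2
     - 4 * exp t * q t * A * snd (c1 s) ^ 2 / den t s ^ 3).
Let gt (t s : R) : plane :=
  (snd (g t s) * (2 * A * fst (g t s) + B) / al t,
   snd (g t s) * (2 * A * snd (g t s) - al t) / al t).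

Lemma icsf_den_pos (t s : R) : flow_time a0 dl t -> I s -> 0 < den t s.
Proof. intros Ht Is. apply (slide_den_pos A B D); auto using icsf_slidable. Qed.

Lemma icsf_level (t s : R) : flow_time a0 dl t -> I s -> level A B D (al t) (g t s).
Proof. intros Ht Is. apply slide_level; auto using icsf_slidable. Qed.

Lemma icsf_derivatives (t s : R) : flow_time a0 dl t -> I s ->
  is_derive_in I (g t) s (gs t s) /\ is_derive_in I (gs t) s (gss t s).
Proof.
  intros Ht Is. assert (Hd := icsf_den_pos t s Ht Is).
  rewrite !is_derive_in_iff by exact Is.
  destruct (regular_curve_coords _ _ _ _ s Hc Is) as (h1 & h2 & h3 & h4).
  unfold gs, gss, h, g, icsf, slide. cbn [fst snd].
  change (slide_q a0 (alpha a0 (discr A B D) t) (exp t)) with (q t).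
  unfold den, slide_den in *. change (slide_q a0 (al t) (exp t)) with (q t) in *.
  change (slide_q a0 (alpha a0 (discr A B D) t) (exp t)) with (q t).
  assert (Hd2 : (exp t + 2 * q t * A * snd (c s)) ^ 2 <> 0) by (apply pow_nonzero; lra).
  repeat split.
  all: (eapply deriv_within_conv; [deriv_tac; lra|]; cbv beta; field; lra).
Qed.

Lemma icsf_time_derivative (J : R -> Prop) (t s : R) : flow_time a0 dl t -> J t -> I s ->
  is_derive_in J (fun t' => g t' s) t (gt t s).
Proof.
  intros Ht Jt Is. assert (Hd := icsf_den_pos t s Ht Is).
  assert (Ha : 0 < al t) by exact (alpha_pos a0 dl t Ht).
  rewrite is_derive_in_iff by exact Jt.
  assert (Hq := slide_q_derive J t Ht).
  assert (Hexp : deriv_within J exp t (exp t))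
    by (apply is_derive_deriv_within; auto_derive; [trivial | ring]).
  unfold gt, g, icsf, slide, den, slide_den in *. cbn [fst snd] in *.
  change (slide_q a0 (al t) (exp t)) with (q t) in *.
  change (slide_q a0 (alpha a0 (discr A B D) t) (exp t)) with (q t).
  fold dl. fold al.
  fold q.
  split.
  all: eapply deriv_within_conv; [deriv_tac; exact (Rgt_not_eq _ _ Hd)|]; cbv beta.
  all: change (slide_q a0 (al t) (exp t)) with (q t); field; lra.
Qed.
(** The sign of the factor has to be carried over from the initial curve: the curvature of [g t] is
    computed from this lemma and cannot be used to find it. *)
Lemma icsf_tangent (t s : R) : flow_time a0 dl t -> I s ->
  exists l, 0 < l /\
    gs t s = (l * - (2 * A * snd (g t s) - al t), l * (2 * A * fst (g t s) + B)).
Proof.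
  intros Ht Is. assert (Hd := icsf_den_pos t s Ht Is).
  assert (exists u, I u /\ u <> s) as [u [Iu Hu]].
  { destruct (Req_dec s0 s) as [<-|h0]; eauto. }
  destruct (level_tangent_of_curvature A B D a0 kappa I c c1 c2 s u)
    as [l [Hl El]]; auto.
  exists (l / den t s). split; [apply Rdiv_lt_0_compat; assumption|].
  assert (Sl := icsf_slidable t Ht).
  assert (N := slide_q_eq A B D a0 (al t) (exp t) Sl).
  assert (L := slide_q_level A B D a0 (al t) (exp t) Sl).
  change (slide_q a0 (al t) (exp t)) with (q t) in N, L.
  destruct (HL s Is) as [_ HLs].
  unfold gs, h, g, icsf, slide. cbn [fst snd]. fold dl al.
  change (slide_den A a0 (al t) (exp t) (c s)) with (den t s).
  change (slide_q a0 (al t) (exp t)) with (q t).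
  assert (Ed : den t s = exp t + 2 * q t * A * snd (c s)) by reflexivity.
  set (d := den t s) in *. set (p := exp t) in *. set (Q := q t) in *. set (a := al t) in *.
  clearbody d p Q a. rewrite El. cbn [fst snd].
  set (x := fst (c s)) in *. set (y := snd (c s)) in *. clearbody x y.
  f_equal.
  - transitivity (l / d * (d * a - 2 * A * y) / d); [|field; lra].
    (* The bracket multiplied by [4 * A * Q] vanishes by the equation of the initial level; it is
       added to make the two sides comparable. *)
    transitivity (l / d * (p * (p * a0 - Q * discr A B D - 2 * A * y * (p + Q * a0)
      + 4 * A * Q * (a0 * y - (A * (x ^ 2 + y ^ 2) + B * x + D)))) / d);
      [unfold discr; field; lra|].
    rewrite HLs, <- L. do 2 f_equal. rewrite Ed.
    transitivity (p * a - 2 * A * y * (p ^ 2 + p * Q * a0)); [ring|].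
    replace (p ^ 2 + p * Q * a0) with (1 - Q * a) by lra. ring.
  - rewrite Ed in *. field. lra.
Qed.


Context (J : R -> Prop) (HJ : forall t, J t -> flow_time a0 dl t).

Section Limits.
Context (t0 t1 : R) (Jt0 : J t0) (It1 : I t1).
Let F := within (fun z : R * R => J (fst z) /\ I (snd z)) (locally (t0, t1)).

Lemma tends_time (f : R -> R) (l : R) :
  tends (within J (locally t0)) f l -> tends F (fun z => f (fst z)) l.
Proof.
  intros H P HP. specialize (H P HP). apply within_eps in H. destruct H as [d [Hd H]].
  exists (mkposreal d Hd). intros z [Hz _] [Jz _]. exact (H (fst z) Jz Hz).
Qed.

Lemma tends_param (f : R -> R) (l : R) :
  tends (within I (locally t1)) f l -> tends F (fun z => f (snd z)) l.
Proof.
  intros H P HP. specialize (H P HP). apply within_eps in H. destruct H as [d [Hd H]].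
  exists (mkposreal d Hd). intros z [_ Hz] [_ Iz]. exact (H (snd z) Iz Hz).
Qed.

Lemma icsf_tends_basic :
  tends F (fun z => exp (fst z)) (exp t0) /\
  tends F (fun z => al (fst z)) (al t0) /\
  tends F (fun z => q (fst z)) (q t0).
Proof.
  assert (Ht := HJ t0 Jt0).
  repeat split; apply (tends_time).
  - apply (deriv_within_lim _ _ _ (exp t0)), is_derive_deriv_within.
    auto_derive; [trivial | ring].
  - exact (deriv_within_lim _ _ _ _ (alpha_derive a0 dl J t0 Ht)).
  - exact (deriv_within_lim _ _ _ _ (slide_q_derive J t0 Ht)).
Qed.

Lemma icsf_tends_curve :
  tends F (fun z => fst (c (snd z))) (fst (c t1)) /\
  tends F (fun z => snd (c (snd z))) (snd (c t1)) /\
  tends F (fun z => fst (c1 (snd z))) (fst (c1 t1)) /\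
  tends F (fun z => snd (c1 (snd z))) (snd (c1 t1)) /\
  tends F (fun z => fst (c2 (snd z))) (fst (c2 t1)) /\
  tends F (fun z => snd (c2 (snd z))) (snd (c2 t1)).
Proof.
  destruct (regular_curve_coords _ _ _ _ t1 Hc It1) as (h1 & h2 & h3 & h4).
  destruct Hc as [_ H2]. specialize (H2 t1 It1). apply tends_pair in H2. destruct H2 as [h5 h6].
  repeat split.
  - exact (tends_param _ _ (deriv_within_lim _ _ _ _ h1)).
  - exact (tends_param _ _ (deriv_within_lim _ _ _ _ h2)).
  - exact (tends_param _ _ (deriv_within_lim _ _ _ _ h3)).
  - exact (tends_param _ _ (deriv_within_lim _ _ _ _ h4)).
  - exact (tends_param _ _ h5).
  - exact (tends_param _ _ h6).
Qed.

Lemma icsf_tends :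
  filterlim (fun z => gs (fst z) (snd z)) F (locally (gs t0 t1)) /\
  filterlim (fun z => gss (fst z) (snd z)) F (locally (gss t0 t1)) /\
  filterlim (fun z => gt (fst z) (snd z)) F (locally (gt t0 t1)).
Proof.
  destruct icsf_tends_basic as (b1 & b2 & b3).
  destruct icsf_tends_curve as (k1 & k2 & k3 & k4 & k5 & k6).
  assert (Hd := icsf_den_pos t0 t1 (HJ t0 Jt0) It1).
  assert (Ha : 0 < al t0) by exact (alpha_pos a0 dl t0 (HJ t0 Jt0)).
  assert (Td : tends F (fun z => den (fst z) (snd z)) (den t0 t1)).
  { unfold den, slide_den. change (fun z : R * R => slide_q a0 (al (fst z)) (exp (fst z)))
      with (fun z : R * R => q (fst z)). tends_tac. }
  assert (Th1 : tends F (fun z => h (c1 (snd z)) (fst z) (snd z)) (h (c1 t1) t0 t1))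
    by (unfold h; tends_tac).
  assert (Th2 : tends F (fun z => h (c2 (snd z)) (fst z) (snd z)) (h (c2 t1) t0 t1))
    by (unfold h; tends_tac).
  assert (Tx : tends F (fun z => fst (g (fst z) (snd z))) (fst (g t0 t1))).
  { apply tends_div; [exact (Rgt_not_eq _ _ Hd) | | exact Td].
    change (tends F (fun z => exp (fst z) * fst (c (snd z)) - q (fst z) * B * snd (c (snd z)))
              (exp t0 * fst (c t1) - q t0 * B * snd (c t1))). tends_tac. }
  assert (Ty : tends F (fun z => snd (g (fst z) (snd z))) (snd (g t0 t1)))
    by (apply tends_div; [exact (Rgt_not_eq _ _ Hd) | exact k2 | exact Td]).
  rewrite !tends_pair. unfold gs, gss, gt. cbn [fst snd].
  assert (N2 : den t0 t1 ^ 2 <> 0) by (apply pow_nonzero; lra).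
  assert (N3 : den t0 t1 ^ 3 <> 0) by (apply pow_nonzero; lra).
  repeat split; tends_tac; lra.
Qed.

End Limits.

Lemma icsf_regular (t : R) : J t -> regular_curve I (g t) (gs t) (gss t).
Proof.
  intros Jt. assert (Ht := HJ t Jt). split.
  - intros s Is. destruct (icsf_level t s Ht Is) as [Hy _].
    split; [exact Hy|]. split; [|apply icsf_derivatives; assumption].
    destruct (icsf_tangent t s Ht Is) as [l [Hl El]]. rewrite El. clear El. intros E.
    assert (G := level_grad_sqr _ _ _ _ _ (icsf_level t s Ht Is)).
    fold dl in G.
    replace (al t ^ 2) with ((a0 ^ 2 + dl) * exp t ^ 2 - dl) in G
      by (symmetry; exact (alpha_sqr a0 dl t Ht)).
    assert (0 < (a0 ^ 2 + dl) * exp t ^ 2)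
      by (apply Rmult_lt_0_compat; [exact HW0 | apply pow_lt, exp_pos]).
    set (x := fst (g t s)) in *. set (y := snd (g t s)) in *. clearbody x y.
    injection E as E1 E2. apply Rmult_integral in E1. apply Rmult_integral in E2.
    destruct E1 as [E1|E1]; [lra|]. destruct E2 as [E2|E2]; [lra|].
    rewrite E2 in G. replace (2 * A * y - al t) with 0 in G by lra. lra.
  - intros s Is. destruct (icsf_tends t s Jt Is) as (_ & H & _).
    apply (filterlim_comp _ _ _ (fun x => (t, x)) (fun z => gss (fst z) (snd z)) _ _ _)
      with (2 := H).
    intros P [d HP]. exists d. intros x Hx Ix. apply HP; [|split; assumption].
    split; [apply ball_center | exact Hx].
Qed.

Lemma icsf_curvature (t s : R) : J t -> I s ->
  curvature (g t s) (gs t s) (gss t s) = al t / sqrt (al t ^ 2 + dl).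
Proof.
  intros Jt Is. assert (Ht := HJ t Jt).
  assert (exists u, I u /\ u <> s) as [u [Iu Hu]].
  { destruct (Req_dec s0 s) as [<-|h0]; eauto. }
  destruct (icsf_tangent t s Ht Is) as [l [Hl El]].
  destruct (level_curve_derivatives A B D (al t) I (g t) (gs t) (gss t) s u) as [_ h2];
    auto using icsf_regular, icsf_level.
  rewrite (level_curvature A B D (al t) l); auto using icsf_level.
  - fold dl. rewrite Rabs_pos_eq by lra. field. split; [|lra].
    apply Rgt_not_eq, sqrt_lt_R0. unfold al; rewrite alpha_sqr by exact Ht.
    assert (0 < (a0 ^ 2 + dl) * exp t ^ 2)
      by (apply Rmult_lt_0_compat; [exact HW0 | apply pow_lt, exp_pos]). lra.
  - fold dl. unfold al; rewrite alpha_sqr by exact Ht.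
    assert (0 < (a0 ^ 2 + dl) * exp t ^ 2)
      by (apply Rmult_lt_0_compat; [exact HW0 | apply pow_lt, exp_pos]). lra.
  - lra.
Qed.

Lemma icsf_0 (s : R) : I s -> g 0 s = c s.
Proof.
  intros _. unfold g, icsf.
  rewrite alpha_0, exp_0 by lra. unfold slide, slide_den, slide_q.
  destruct (c s) as [x y]. cbn [fst snd]. f_equal; field; lra.
Qed.

Context (HJi : is_interval J) (J0 : J 0).

Lemma icsf_evolves : evolves_with_constant_curvature I J c g.
Proof.
  assert (HWt : forall t, 0 < (a0 ^ 2 + dl) * exp t ^ 2).
  { intros t. apply Rmult_lt_0_compat; [exact HW0 | apply pow_lt, exp_pos]. }
  split.
  - split; [exact HJi|]. split; [exact J0|]. split; [exact icsf_0|].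
    exists gs, gss, gt. split; [exact icsf_regular|].
    split; [intros; apply icsf_time_derivative; auto|].
    split; [intros [t s] [Jt Is]; exact (proj1 (icsf_tends t s Jt Is))|].
    split; [intros [t s] [Jt Is]; exact (proj1 (proj2 (icsf_tends t s Jt Is)))|].
    split; [intros [t s] [Jt Is]; exact (proj2 (proj2 (icsf_tends t s Jt Is)))|].
    intros t s Jt Is. cbv zeta. rewrite icsf_curvature by assumption.
    assert (Ht := HJ t Jt). assert (Ha : 0 < al t) by exact (alpha_pos a0 dl t Ht).
    assert (HW : 0 < al t ^ 2 + dl)
      by (unfold al; rewrite alpha_sqr by exact Ht; specialize (HWt t); lra).
    split.
    + apply Rgt_not_eq, Rdiv_lt_0_compat; [exact Ha | apply sqrt_lt_R0, HW].
    + destruct (icsf_tangent t s Ht Is) as [l [Hl El]].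
      apply (level_normal_part A B D (al t) l); auto using icsf_level.
  - intros t Jt. exists (al t / sqrt (al t ^ 2 + dl)), (gs t), (gss t).
    split; [apply icsf_regular, Jt | intros; apply icsf_curvature; assumption].
Qed.

(** An extension would contain the time [T] at which [alpha] vanishes. Its curvature is continuous
    in time and agrees with that of [g] after [T], so it would be 0 at [T], which the flow equation
    forbids. The extension is not assumed to have constant curvature. *)
Lemma icsf_not_extendable : (forall t, flow_time a0 dl t -> J t) -> not_extendable I J c g.
Proof.
  intros HJ' J' g' (HJ'i & J'0 & _ & gs' & gss' & gt' & Hreg & Hder & Cs & Css & _ & Hev)
    Hsub Hext t J't.
  apply HJ'. apply NNPP. intros Hnt. unfold flow_time in Hnt.
  assert (Hdl : 0 < dl).
  { assert (0 < (a0 ^ 2 + dl) * exp (2 * t))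
      by (apply Rmult_lt_0_compat; [exact HW0 | apply exp_pos]). lra. }
  (* The zero of the radicand of [alpha]; it exists because a time outside [flow_time] forces [dl]
     to be positive. *)
  set (T := ln (dl / (a0 ^ 2 + dl)) / 2).
  assert (HT : exp (2 * T) = dl / (a0 ^ 2 + dl)).
  { unfold T. replace (2 * (ln (dl / (a0 ^ 2 + dl)) / 2)) with (ln (dl / (a0 ^ 2 + dl))) by field.
    apply exp_ln, Rdiv_lt_0_compat; assumption. }
  assert (HTt : forall x, T < x -> J x).
  { intros x Hx. apply HJ'. unfold flow_time.
    replace dl with ((a0 ^ 2 + dl) * exp (2 * T)) at 1
      by (rewrite HT; field; fold dl in HW0; lra).
    apply Rmult_lt_compat_l; [exact HW0 | apply exp_increasing; lra]. }
  assert (T0 : T < 0).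
  { destruct (Rlt_or_le T 0) as [h0|h0]; [exact h0|exfalso].
    assert (Hle : 1 <= exp (2 * T)) by (assert (h1 := exp_ineq1_le (2 * T)); lra).
    rewrite HT in Hle. apply (Rmult_le_compat_r (a0 ^ 2 + dl)) in Hle;
      [|left; exact HW0].
    replace (dl / (a0 ^ 2 + dl) * (a0 ^ 2 + dl)) with dl in Hle
      by (field; fold dl in HW0; lra). nra. }
  assert (J'T : J' T).
  { apply (HJ'i t 0 T); try assumption. split; [|lra].
    (* Times after [T] belong to [J] and hence satisfy [flow_time], unlike [t]. *)
    destruct (Rle_or_lt t T) as [h0|h0]; [exact h0|].
    exfalso. apply Hnt, HJ, HTt, h0. }
  assert (PF := within_proper (fun x => T <= x) T 0 ltac:(intros ? ? ?; lra)
                  ltac:(lra) ltac:(lra) ltac:(lra)).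
  set (F := within (fun x => T <= x /\ x <> T) (locally T)) in *.
  set (k := fun x => curvature (g' x s0) (gs' x s0) (gss' x s0)).
  assert (K0 : k T <> 0) by apply (Hev T s0 J'T Is0).
  apply K0.
  assert (Sub : forall x, T <= x /\ x <> T -> J' x)
    by (intros x Hx; apply Hsub, HTt; lra).
  apply (@filterlim_locally_unique _ _ R_NormedModule F _ k).
  - apply (tends_within_subset J' _ _ k _ Sub).
    apply tends_curvature.
    + apply (Hreg T J'T), Is0.
    + apply (is_derive_in_continuous J' (fun x => g' x s0) T (gt' T s0)); auto.
    + exact (continuous_on_slice I J' gs' T s0 Cs J'T Is0).
    + exact (continuous_on_slice I J' gss' T s0 Css J'T Is0).
  - assert (He : exp (2 * T) <> 0) by apply Rgt_not_eq, exp_pos.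
    assert (Te : tends F (fun x => exp (2 * x)) (exp (2 * T))).
    { apply (tends_within_subset (fun _ => True) _ _ _ _ (fun x _ => Logic.I)).
      apply (deriv_within_lim _ _ (fun x => exp (2 * x)) (2 * exp (2 * T))), is_derive_deriv_within.
      auto_derive; [trivial | ring]. }
    assert (Hz : al T / sqrt ((a0 ^ 2 + dl) * exp (2 * T)) = 0).
    { unfold al, alpha. rewrite HT.
      replace ((a0 ^ 2 + dl) * (dl / (a0 ^ 2 + dl)) - dl) with 0
        by (field; fold dl in HW0; lra).
      rewrite sqrt_0. apply Rmult_0_l. }
    change (tends F k 0). rewrite <- Hz.
    apply (tends_ext (fun x => al x / sqrt ((a0 ^ 2 + dl) * exp (2 * x)))).
    + unfold F, within. apply filter_forall. intros x Hx.
      assert (Jx : J x) by (apply HTt; lra).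
      unfold k. rewrite (Hext x s0 Jx Is0).
      destruct (regular_curve_unique I (g x) (gs x) (gss x) (g' x) (gs' x) (gss' x) s0 s1)
        with (s := s0) as [<- <-]; auto using icsf_regular.
      { intros s Is. symmetry. apply Hext; assumption. }
      rewrite icsf_curvature by assumption. unfold al; rewrite alpha_sqr by auto.
      rewrite exp_double. do 2 f_equal. ring.
    + unfold al, alpha. tends_tac.
      apply Rgt_not_eq, sqrt_lt_R0. apply Rmult_lt_0_compat; [exact HW0 | apply exp_pos].
Qed.

(** No end of the curve is lost: a point of the later level slides back to the initial level, all of
    which is covered by [c]. *)
Lemma icsf_trace (t : R) : J t -> same_set (trace I c) (level A B D a0) ->
  same_set (trace I (g t)) (level A B D (al t)).
Proof.
  intros Jt HS z. assert (Sl := icsf_slidable t (HJ t Jt)). split.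
  - intros [s [Is <-]]. apply icsf_level; auto.
  - intros Hz. assert (Sl' := slidable_inv _ _ _ _ _ _ Sl).
    destruct (proj2 (HS _) (slide_level A B D _ _ _ Sl' z Hz)) as [s [Is Es]].
    exists s. split; [exact Is|]. unfold g, icsf. rewrite Es.
    replace (exp t) with (/ / exp t) by (field; apply Rgt_not_eq, exp_pos).
    fold dl al. rewrite !Rinv_inv. rewrite <- (Rinv_inv (exp t)) at 1.
    apply (slide_inv A B D); assumption.
Qed.

End Curve.
End Existence.

(** * Uniqueness of the flow *)

(** [coefA (x^2 + y^2) + coefB x + coefD = y] is the curve of constant curvature
    [k] through [z] with velocity [v]: the gradient of the left-hand side minus
    [y] is [(v_y, - v_x) / (k |v|)]. *)
Definition coefA (z v : plane) (k : R) : R := (1 - fst v / (k * enorm v)) / (2 * snd z).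
Definition coefB (z v : plane) (k : R) : R :=
  snd v / (k * enorm v) - 2 * coefA z v k * fst z.
Definition coefD (z v : plane) (k : R) : R :=
  snd z - coefA z v k * (fst z ^ 2 + snd z ^ 2) - coefB z v k * fst z.

Lemma coef_level (z v : plane) (k : R) : halfplane z ->
  level (coefA z v k) (coefB z v k) (coefD z v k) 1 z.
Proof. intros Hz. split; [exact Hz|]. unfold coefD. ring. Qed.

Lemma coef_grad (z v : plane) (k : R) : halfplane z -> k <> 0 -> v <> (0, 0) ->
  2 * coefA z v k * fst z + coefB z v k = snd v / (k * enorm v) /\
  2 * coefA z v k * snd z - 1 = - (fst v / (k * enorm v)).
Proof.
  intros Hz Hk Hv. unfold halfplane in Hz. assert (H := enorm_pos v Hv).
  split; [unfold coefB; ring | unfold coefA; field; lra].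
Qed.

Lemma enorm_sqr (v : plane) : enorm v ^ 2 = fst v ^ 2 + snd v ^ 2.
Proof. unfold enorm. rewrite <- Rsqr_pow2. apply Rsqr_sqrt. nra. Qed.

(** The left-hand side is the squared gradient on level 1, and by [coef_grad] that gradient has
    length [1 / |k|]. *)
Lemma coef_discr (z v : plane) (k : R) : halfplane z -> k <> 0 -> v <> (0, 0) ->
  1 + discr (coefA z v k) (coefB z v k) (coefD z v k) = 1 / k ^ 2.
Proof.
  intros Hz Hk Hv. assert (H := level_grad_sqr _ _ _ _ _ (coef_level z v k Hz)).
  destruct (coef_grad z v k Hz Hk Hv) as [E1 E2]. rewrite E1, E2 in H.
  rewrite pow1 in H. rewrite <- H. assert (Hn := enorm_pos v Hv).
  transitivity ((fst v ^ 2 + snd v ^ 2) / (k * enorm v) ^ 2); [field; lra|].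
  rewrite <- enorm_sqr. field. lra.
Qed.

Section ConstantCurvature.
Context (I : R -> Prop) (c c1 c2 : R -> plane) (k : R) (HI : is_interval I)
  (Hc : regular_curve I c c1 c2) (Hk : k <> 0)
  (Hcurv : forall s, I s -> curvature (c s) (c1 s) (c2 s) = k).

Let cross (s : R) : R := fst (c1 s) * snd (c2 s) - snd (c1 s) * fst (c2 s).

(** Frenet's formula for the Euclidean unit tangent divided by [k]; [cross s / enorm (c1 s) ^ 3] is
    the Euclidean curvature. *)
Lemma unit_tangent_derivative (s : R) : I s ->
  deriv_within I (fun x => fst (c1 x) / (k * enorm (c1 x))) s
    (- snd (c1 s) * cross s / (k * enorm (c1 s) ^ 3)) /\
  deriv_within I (fun x => snd (c1 x) / (k * enorm (c1 x))) s
    (fst (c1 s) * cross s / (k * enorm (c1 s) ^ 3)).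
Proof.
  intros Is. destruct (regular_curve_coords _ _ _ _ s Hc Is) as (_ & _ & h1 & h2).
  assert (Hn : 0 < enorm (c1 s)) by apply enorm_pos, (proj1 Hc s Is).
  assert (Hn2 := enorm_sqr (c1 s)).
  assert (0 < fst (c1 s) ^ 2 + snd (c1 s) ^ 2) by (rewrite <- Hn2; nra).
  assert (Dn : deriv_within I (fun x => enorm (c1 x)) s
    ((fst (c1 s) * fst (c2 s) + snd (c1 s) * snd (c2 s)) / enorm (c1 s))).
  { unfold enorm in *. eapply deriv_within_conv; [deriv_tac; lra|]. cbv beta. field. lra. }
  assert (k * enorm (c1 s) <> 0) by (apply Rmult_integral_contrapositive_currified; lra).
  unfold cross. split.
  all: (eapply deriv_within_conv; [deriv_tac; lra|]); cbv beta.
  - transitivity ((fst (c2 s) * enorm (c1 s) ^ 2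
      - fst (c1 s) * (fst (c1 s) * fst (c2 s) + snd (c1 s) * snd (c2 s)))
      / (k * enorm (c1 s) ^ 3)); [field; lra|].
    rewrite Hn2. field. lra.
  - transitivity ((snd (c2 s) * enorm (c1 s) ^ 2
      - snd (c1 s) * (fst (c1 s) * fst (c2 s) + snd (c1 s) * snd (c2 s)))
      / (k * enorm (c1 s) ^ 3)); [field; lra|].
    rewrite Hn2. field. lra.
Qed.

(** The equation [curvature = k] solved for the Euclidean curvature. *)
Lemma cross_eq (s : R) : I s ->
  cross s / (k * enorm (c1 s) ^ 3) = 2 * coefA (c s) (c1 s) k.
Proof.
  intros Is. destruct Hc as [H _]. destruct (H s Is) as (Hy & Hv & _).
  unfold halfplane in Hy. assert (Hn := enorm_pos _ Hv).
  unfold coefA. apply (Rmult_eq_reg_l (k * snd (c s)));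
    [|apply Rmult_integral_contrapositive_currified; lra].
  transitivity (k - fst (c1 s) / enorm (c1 s)); [|field; lra].
  assert (E := Hcurv s Is). unfold curvature, euclidean_curvature in E. fold (cross s) in E.
  transitivity (snd (c s) * (cross s / enorm (c1 s) ^ 3)); [field; lra | lra].
Qed.

(** The derivatives vanish one after the other: that of [coefA] by Frenet's formula and [cross_eq],
    then that of [coefB], and finally that of [coefD] because the velocity is orthogonal to the
    gradient. *)
Lemma coef_constant (s u : R) : I s -> I u ->
  coefA (c s) (c1 s) k = coefA (c u) (c1 u) k /\
  coefB (c s) (c1 s) k = coefB (c u) (c1 u) k /\
  coefD (c s) (c1 s) k = coefD (c u) (c1 u) k.
Proof.
  intros Is Iu.
  assert (DA : forall x, I x -> deriv_within I (fun x => coefA (c x) (c1 x) k) x 0).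
  { intros x Ix. destruct (unit_tangent_derivative x Ix) as [h1 _].
    destruct (regular_curve_coords _ _ _ _ x Hc Ix) as (_ & h3 & _ & _).
    assert (Hy : 0 < snd (c x)) by apply (proj1 Hc x Ix).
    assert (E := cross_eq x Ix).
    unfold coefA in *. eapply deriv_within_conv; [deriv_tac; lra|]. cbv beta.
    replace (- snd (c1 x) * cross x / (k * enorm (c1 x) ^ 3))
      with (- snd (c1 x) * (cross x / (k * enorm (c1 x) ^ 3))) by (unfold Rdiv; ring).
    rewrite E. unfold Rdiv at 1. apply Rmult_eq_0_compat_r.
    set (m := 1 - fst (c1 x) / (k * enorm (c1 x))). field. lra. }
  assert (DB : forall x, I x -> deriv_within I (fun x => coefB (c x) (c1 x) k) x 0).
  { intros x Ix. destruct (unit_tangent_derivative x Ix) as [_ h1].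
    destruct (regular_curve_coords _ _ _ _ x Hc Ix) as (h2 & _ & _ & _).
    assert (h := DA x Ix). assert (E := cross_eq x Ix).
    unfold coefB. eapply deriv_within_conv; [deriv_tac|]. cbv beta.
    replace (fst (c1 x) * cross x / (k * enorm (c1 x) ^ 3))
      with (fst (c1 x) * (cross x / (k * enorm (c1 x) ^ 3))) by (unfold Rdiv; ring).
    rewrite E. ring. }
  assert (DD : forall x, I x -> deriv_within I (fun x => coefD (c x) (c1 x) k) x 0).
  { intros x Ix.
    destruct (regular_curve_coords _ _ _ _ x Hc Ix) as (h2 & h3 & _ & _).
    assert (hA := DA x Ix). assert (hB := DB x Ix).
    destruct (proj1 Hc x Ix) as (Hy & Hv & _).
    destruct (coef_grad (c x) (c1 x) k Hy Hk Hv) as [G1 G2].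
    unfold coefD. eapply deriv_within_conv; [deriv_tac|]. cbv beta.
    transitivity (- ((2 * coefA (c x) (c1 x) k * fst (c x) + coefB (c x) (c1 x) k) * fst (c1 x)
      + (2 * coefA (c x) (c1 x) k * snd (c x) - 1) * snd (c1 x))); [ring|].
    rewrite G1, G2. unfold Rdiv. ring. }
  repeat split.
  - exact (deriv_within_zero I _ HI DA s u Is Iu).
  - exact (deriv_within_zero I _ HI DB s u Is Iu).
  - exact (deriv_within_zero I _ HI DD s u Is Iu).
Qed.

(** A nontrivial relation would place the curve on a level with [al = 0], that is on a geodesic,
    against [k <> 0]. *)
Lemma curve_spans (s u w1 w2 w3 : R) : I s -> I u -> u <> s ->
  (forall x, I x -> w1 * (fst (c x) ^ 2 + snd (c x) ^ 2) + w2 * fst (c x) + w3 = 0) ->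
  w1 = 0 /\ w2 = 0 /\ w3 = 0.
Proof.
  intros Is Iu Hus Hw.
  destruct (level_curve_derivatives w1 w2 w3 0 I c c1 c2 s u) as [T1 T2]; try assumption.
  { intros x Ix. split; [apply (proj1 Hc x Ix)|]. rewrite Hw by exact Ix. ring. }
  destruct (proj1 Hc s Is) as (Hy & Hv & _). unfold halfplane in Hy.
  assert (Hn := enorm_pos _ Hv). assert (Hn2 := enorm_sqr (c1 s)).
  (* The left-hand side is the determinant of the system [T1], [T3] in the gradient [(P, Q)]; as it
     is nonzero, Cramer's rule gives [P = Q = 0]. *)
  assert (K : enorm (c1 s) ^ 2 * fst (c1 s) + snd (c s) * cross s = k * enorm (c1 s) ^ 3).
  { rewrite <- (Hcurv s Is). unfold curvature, euclidean_curvature. fold (cross s).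
    field. lra. }
  assert (K0 : k * enorm (c1 s) ^ 3 <> 0).
  { apply Rmult_integral_contrapositive_currified; [exact Hk | apply pow_nonzero; lra]. }
  rewrite <- Hn2 in T2. unfold cross in K. specialize (Hw s Is).
  set (P := 2 * w1 * fst (c s) + w2) in *. set (Q := 2 * w1 * snd (c s) - 0) in *.
  assert (T3 : Q * enorm (c1 s) ^ 2 + snd (c s) * (P * fst (c2 s) + Q * snd (c2 s)) = 0).
  { transitivity (snd (c s) * (2 * w1 * enorm (c1 s) ^ 2 + P * fst (c2 s) + Q * snd (c2 s)));
      [unfold Q; ring|]. rewrite T2. ring. }
  assert (Q0 : Q = 0).
  { apply (Rmult_eq_reg_r (k * enorm (c1 s) ^ 3)); [|exact K0]. rewrite <- K.
    transitivity (fst (c1 s) * (Q * enorm (c1 s) ^ 2 + snd (c s) * (P * fst (c2 s) + Q * snd (c2 s)))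
      - snd (c s) * fst (c2 s) * (P * fst (c1 s) + Q * snd (c1 s))); [ring|].
    rewrite T3, T1. ring. }
  assert (P0 : P = 0).
  { apply (Rmult_eq_reg_r (k * enorm (c1 s) ^ 3)); [|exact K0]. rewrite <- K.
    transitivity ((enorm (c1 s) ^ 2 + snd (c s) * snd (c2 s)) * (P * fst (c1 s) + Q * snd (c1 s))
      - snd (c1 s) * (Q * enorm (c1 s) ^ 2 + snd (c s) * (P * fst (c2 s) + Q * snd (c2 s))));
      [ring|].
    rewrite T3, T1. ring. }
  assert (w1 = 0) as -> by (unfold Q in Q0; nra).
  assert (w2 = 0) as -> by (unfold P in P0; lra). lra.
Qed.

End ConstantCurvature.

Lemma spanning_three_points (I : R -> Prop) (r x : R -> R) :
  (exists s, I s) ->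
  (forall w1 w2 w3, (forall s, I s -> w1 * r s + w2 * x s + w3 = 0) ->
     w1 = 0 /\ w2 = 0 /\ w3 = 0) ->
  exists s1 s2 s3, I s1 /\ I s2 /\ I s3 /\
    r s1 * (x s2 - x s3) + r s2 * (x s3 - x s1) + r s3 * (x s1 - x s2) <> 0.
Proof.
  intros [s1 I1] H.
  assert (exists s2, I s2 /\ x s2 <> x s1) as [s2 [I2 H2]].
  { apply NNPP. intros N. destruct (H 0 1 (- x s1)) as (_ & h & _); [|lra].
    intros s Is. destruct (Req_dec (x s) (x s1)) as [->|h]; [ring|].
    exfalso. apply N. eauto. }
  apply NNPP. intros N.
  (* The cofactors of the third row: if every determinant vanished, they would form a linear
     relation with nonzero first coefficient. *)
  destruct (H (x s1 - x s2) (r s2 - r s1) (r s1 * x s2 - x s1 * r s2)) as (h & _); [|lra].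
  intros s Is. apply NNPP. intros N'. apply N. exists s1, s2, s.
  repeat (split; [assumption|]). intros h. apply N'. rewrite <- h. ring.
Qed.

(** The coefficients are only known to be continuous in [t]; solving for their
    increments with the matrix frozen at [t] makes them differentiable. *)
Lemma coefficients_derivative (J : R -> Prop) (a b d : R -> R) (t m : R)
  (r x y : R -> R -> R) (r' x' y' : R -> R) (s1 s2 s3 : R) :
  J t ->
  tends (within J (locally t)) a (a t) -> tends (within J (locally t)) b (b t) ->
  (forall t' s, J t' -> s = s1 \/ s = s2 \/ s = s3 ->
     a t' * r t' s + b t' * x t' s + d t' = y t' s) ->
  (forall s, s = s1 \/ s = s2 \/ s = s3 ->
     deriv_within J (fun t' => r t' s) t (r' s) /\
     deriv_within J (fun t' => x t' s) t (x' s) /\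
     deriv_within J (fun t' => y t' s) t (y' s) /\
     y' s - r' s * a t - x' s * b t = - m * y t s) ->
  r t s1 * (x t s2 - x t s3) + r t s2 * (x t s3 - x t s1) + r t s3 * (x t s1 - x t s2) <> 0 ->
  deriv_within J a t (- m * a t) /\ deriv_within J b t (- m * b t) /\
  deriv_within J d t (- m * d t).
Proof.
  intros Jt Ta Tb Hrel Hder Hdet.
  set (H := fun s t' => (y t' s - y t s) - (r t' s - r t s) * a t' - (x t' s - x t s) * b t').
  assert (DH : forall s, s = s1 \/ s = s2 \/ s = s3 ->
    deriv_within J (H s) t (- m * y t s)).
  { intros s Hs. destruct (Hder s Hs) as (h1 & h2 & h3 & <-). unfold H.
    apply deriv_within_minus; [apply deriv_within_minus|].
    - eapply deriv_within_conv; [deriv_tac | ring].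
    - apply deriv_within_mult_cont; [ring | | exact Ta].
      eapply deriv_within_conv; [deriv_tac | ring].
    - apply deriv_within_mult_cont; [ring | | exact Tb].
      eapply deriv_within_conv; [deriv_tac | ring]. }
  assert (HH : forall s t', J t' -> s = s1 \/ s = s2 \/ s = s3 ->
    H s t' = (a t' - a t) * r t s + (b t' - b t) * x t s + (d t' - d t)).
  { intros s t' Jt' Hs. unfold H. rewrite <- (Hrel t' s Jt' Hs), <- (Hrel t s Jt Hs). ring. }
  assert (D1 := DH s1 ltac:(auto)). assert (D2 := DH s2 ltac:(auto)).
  assert (D3 := DH s3 ltac:(auto)).
  assert (E1 := fun t' h => HH s1 t' h ltac:(auto)).
  assert (E2 := fun t' h => HH s2 t' h ltac:(auto)).
  assert (E3 := fun t' h => HH s3 t' h ltac:(auto)).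
  rewrite <- (Hrel t s1 Jt ltac:(auto)) in D1. rewrite <- (Hrel t s2 Jt ltac:(auto)) in D2.
  rewrite <- (Hrel t s3 Jt ltac:(auto)) in D3.
  clearbody H. clear DH HH Hrel Hder.
  set (det := r t s1 * (x t s2 - x t s3) + r t s2 * (x t s3 - x t s1)
              + r t s3 * (x t s1 - x t s2)) in *.
  assert (DA : deriv_within J a t (- m * a t)).
  { apply (deriv_within_ext _ _ (fun t' => a t + / det * (H s1 t' * (x t s2 - x t s3)
      + H s2 t' * (x t s3 - x t s1) + H s3 t' * (x t s1 - x t s2)))); [exact Jt| |].
    - intros t' Jt'. rewrite E1, E2, E3 by exact Jt'. unfold det in *. field. exact Hdet.
    - eapply deriv_within_conv; [deriv_tac|]. unfold det in *. cbv beta. field. exact Hdet. }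
  assert (DB : deriv_within J b t (- m * b t)).
  { apply (deriv_within_ext _ _ (fun t' => b t + / det * (H s1 t' * (r t s3 - r t s2)
      + H s2 t' * (r t s1 - r t s3) + H s3 t' * (r t s2 - r t s1)))); [exact Jt| |].
    - intros t' Jt'. rewrite E1, E2, E3 by exact Jt'. unfold det in *. field. exact Hdet.
    - eapply deriv_within_conv; [deriv_tac|]. unfold det in *. cbv beta. field. exact Hdet. }
  repeat split; [exact DA | exact DB |].
  apply (deriv_within_ext _ _ (fun t' => d t + H s1 t' - (a t' - a t) * r t s1
    - (b t' - b t) * x t s1)); [exact Jt| |].
  - intros t' Jt'. rewrite E1 by exact Jt'. ring.
  - eapply deriv_within_conv; [deriv_tac|]. cbv beta. ring.
Qed.

Section CoefficientEvolution.
Context (I J : R -> Prop) (c : R -> plane) (g : R -> R -> plane) (s0 s1 : R)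
  (HI : is_interval I) (Is0 : I s0) (Is1 : I s1) (Hs01 : s0 <> s1).

(** The left-hand side is the velocity [w] paired with the gradient from [coef_grad]. The vector
    equation gives one scalar equation, read off from a nonzero component of the normal. *)
Lemma normal_speed (p v w : plane) (k : R) :
  halfplane p -> v <> (0, 0) -> k <> 0 ->
  normal_part p v w = scal (- (1 / k)) (unit_normal p v) ->
  (fst w * snd v - snd w * fst v) / (k * enorm v) = snd p / k ^ 2.
Proof.
  intros Hp Hv Hk H. unfold halfplane in Hp. assert (Hn := enorm_pos v Hv).
  assert (E : hmetric p w (unit_normal p v) = - (1 / k)).
  { unfold normal_part in H. injection H as H1 H2.
    change (hmetric p w (unit_normal p v) * (snd p * - snd v / enorm v)
            = - (1 / k) * (snd p * - snd v / enorm v)) in H1.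
    change (hmetric p w (unit_normal p v) * (snd p * fst v / enorm v)
            = - (1 / k) * (snd p * fst v / enorm v)) in H2.
    set (h := hmetric p w (unit_normal p v)) in *. clearbody h.
    destruct (Req_dec (fst v) 0) as [h1|h1].
    - assert (h2 : snd v <> 0).
      { intros h2. apply Hv. rewrite (surjective_pairing v), h1, h2. reflexivity. }
      apply (Rmult_eq_reg_r _ _ _ H1). unfold Rdiv.
      repeat apply Rmult_integral_contrapositive_currified; try lra.
      apply Rinv_neq_0_compat. lra.
    - apply (Rmult_eq_reg_r _ _ _ H2). unfold Rdiv.
      repeat apply Rmult_integral_contrapositive_currified; try lra.
      apply Rinv_neq_0_compat. lra. }
  unfold hmetric, unit_normal in E. cbn [fst snd] in E.
  transitivity (- snd p / k * ((fst w * (snd p * - snd v / enorm v)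
    + snd w * (snd p * fst v / enorm v)) / snd p ^ 2)); [field; lra|].
  rewrite E. field. lra.
Qed.

(** Differentiating the equation of the curve in time at fixed [s], the moving point contributes
    [snd (g t s) / k t ^ 2] by [normal_speed]. By the equation itself this is [1 / k t ^ 2] times
    the coefficient combination, and three independent points isolate each coefficient. *)
Lemma evolution_coefficients :
  evolves_with_constant_curvature I J c g ->
  exists a b d : R -> R, forall t, J t ->
    (forall s, I s -> level (a t) (b t) (d t) 1 (g t s)) /\
    0 < 1 + discr (a t) (b t) (d t) /\
    deriv_within J a t (- (1 + discr (a t) (b t) (d t)) * a t) /\
    deriv_within J b t (- (1 + discr (a t) (b t) (d t)) * b t) /\
    deriv_within J d t (- (1 + discr (a t) (b t) (d t)) * d t).
Proof.
  intros [(HJi & J0 & _ & gs & gss & gt & Hreg & Hder & Cs & Css & _ & Hev) Hcc].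
  set (k := fun t => curvature (g t s0) (gs t s0) (gss t s0)).
  assert (Hk : forall t, J t -> k t <> 0) by (intros t Jt; apply (Hev t s0 Jt Is0)).
  assert (Hcurv : forall t s, J t -> I s -> curvature (g t s) (gs t s) (gss t s) = k t).
  { intros t s Jt Is. destruct (Hcc t Jt) as (k' & c1 & c2 & Hc & Hk').
    assert (U := regular_curve_unique I (g t) c1 c2 (g t) (gs t) (gss t) s0 s1 HI Is0 Is1 Hs01
                   Hc (Hreg t Jt) (fun _ _ => eq_refl)).
    unfold k. destruct (U s Is) as [<- <-], (U s0 Is0) as [<- <-].
    rewrite !Hk' by assumption. reflexivity. }
  set (a := fun t => coefA (g t s0) (gs t s0) (k t)).
  set (b := fun t => coefB (g t s0) (gs t s0) (k t)).
  set (d := fun t => coefD (g t s0) (gs t s0) (k t)).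
  assert (Hconst : forall t s, J t -> I s ->
    a t = coefA (g t s) (gs t s) (k t) /\ b t = coefB (g t s) (gs t s) (k t) /\
    d t = coefD (g t s) (gs t s) (k t)).
  { intros t s Jt Is. apply (coef_constant I (g t) (gs t) (gss t) (k t)); auto. }
  assert (Hlev : forall t s, J t -> I s -> level (a t) (b t) (d t) 1 (g t s)).
  { intros t s Jt Is. destruct (Hconst t s Jt Is) as (-> & -> & ->).
    apply coef_level, (proj1 (Hreg t Jt) s Is). }
  exists a, b, d. intros t Jt.
  assert (Hm : 1 + discr (a t) (b t) (d t) = 1 / k t ^ 2).
  { destruct (proj1 (Hreg t Jt) s0 Is0) as (h1 & h2 & _). apply coef_discr; auto. }
  split; [auto|]. split.
  { rewrite Hm. apply Rdiv_lt_0_compat; [lra|]. assert (h := Hk t Jt). nra. }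
  rewrite Hm.
  assert (Tz : filterlim (fun t' => g t' s0) (within J (locally t)) (locally (g t s0)))
    by (apply (is_derive_in_continuous J (fun t' => g t' s0) t (gt t s0)); auto).
  assert (Tv := continuous_on_slice I J gs t s0 Cs Jt Is0).
  assert (Ta := continuous_on_slice I J gss t s0 Css Jt Is0).
  destruct (proj1 (Hreg t Jt) s0 Is0) as (Hy0 & Hv0 & _). unfold halfplane in Hy0.
  assert (Tk : tends (within J (locally t)) k (k t)) by (apply tends_curvature; assumption).
  assert (Te := tends_enorm _ _ Tv). apply tends_pair in Tz, Tv.
  destruct Tz as [Tz1 Tz2], Tv as [Tv1 Tv2].
  assert (Hn0 := enorm_pos _ Hv0).
  assert (Hkn : k t * enorm (gs t s0) <> 0)
    by (apply Rmult_integral_contrapositive_currified; [auto | lra]).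
  assert (TA : tends (within J (locally t)) a (a t)) by (unfold a, coefA; tends_tac; lra).
  assert (TB : tends (within J (locally t)) b (b t)).
  { unfold b, coefB. fold (a t). change (fun t0 => coefA (g t0 s0) (gs t0 s0) (k t0)) with a.
    tends_tac; assumption. }
  destruct (spanning_three_points I (fun s => fst (g t s) ^ 2 + snd (g t s) ^ 2)
              (fun s => fst (g t s))) as (p1 & p2 & p3 & I1 & I2 & I3 & Hdet).
  { exists s0. exact Is0. }
  { intros w1 w2 w3 Hw.
    apply (curve_spans I (g t) (gs t) (gss t) (k t)) with (s := s0) (u := s1); auto. }
  apply (coefficients_derivative J a b d t (1 / k t ^ 2)
    (fun t s => fst (g t s) ^ 2 + snd (g t s) ^ 2) (fun t s => fst (g t s))
    (fun t s => snd (g t s))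
    (fun s => 2 * fst (g t s) * fst (gt t s) + 2 * snd (g t s) * snd (gt t s))
    (fun s => fst (gt t s)) (fun s => snd (gt t s)) p1 p2 p3); try assumption.
  - intros t' s Jt' Hs. assert (Is : I s) by (destruct Hs as [->|[->|]]; subst; assumption).
    destruct (Hlev t' s Jt' Is) as [_ E]. lra.
  - intros s Hs. assert (Is : I s) by (destruct Hs as [->|[->|]]; subst; assumption).
    assert (h := Hder t s Jt Is). apply is_derive_in_iff in h; [|exact Jt].
    destruct h as [h1 h2].
    split; [deriv_tac|]. split; [exact h1|]. split; [exact h2|].
    destruct (proj1 (Hreg t Jt) s Is) as (Hy & Hv & _).
    destruct (Hev t s Jt Is) as [_ Hn]. rewrite Hcurv in Hn by assumption.
    apply normal_speed in Hn; auto.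
    destruct (coef_grad (g t s) (gs t s) (k t) Hy (Hk t Jt) Hv) as [G1 G2].
    destruct (Hconst t s Jt Is) as (EA & EB & _). rewrite <- EA in G1, G2. rewrite <- EB in G1.
    transitivity (- ((2 * a t * fst (g t s) + b t) * fst (gt t s)
      + (2 * a t * snd (g t s) - 1) * snd (gt t s))); [ring|].
    rewrite G1, G2.
    transitivity (- ((fst (gt t s) * snd (gs t s) - snd (gt t s) * fst (gs t s))
      / (k t * enorm (gs t s)))); [unfold Rdiv; ring|].
    rewrite Hn. unfold Rdiv. ring.
Qed.

End CoefficientEvolution.

(** The speed [m = 1 + discr] obeys a closed scalar equation, [m' = - 2 m (m - 1)]. Its first
    integral expresses [alpha] through [m], after which the products of the coefficients with
    [alpha] are seen to be constant. *)
Lemma coefficients_solution (J : R -> Prop) (a b d : R -> R) (a0 : R) :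
  is_interval J -> J 0 -> 0 < a0 ->
  (forall t, J t ->
    0 < 1 + discr (a t) (b t) (d t) /\
    deriv_within J a t (- (1 + discr (a t) (b t) (d t)) * a t) /\
    deriv_within J b t (- (1 + discr (a t) (b t) (d t)) * b t) /\
    deriv_within J d t (- (1 + discr (a t) (b t) (d t)) * d t)) ->
  let dl := discr (a0 * a 0) (a0 * b 0) (a0 * d 0) in
  forall t, J t ->
    flow_time a0 dl t /\
    a t * alpha a0 dl t = a0 * a 0 /\ b t * alpha a0 dl t = a0 * b 0 /\
    d t * alpha a0 dl t = a0 * d 0.
Proof.
  intros HJ J0 Ha0 H dl.
  set (m := fun t => 1 + discr (a t) (b t) (d t)) in *.
  assert (Dexp : forall t, deriv_within J (fun t => exp (2 * t)) t (2 * exp (2 * t)))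
    by (intros t; apply is_derive_deriv_within; auto_derive; [trivial | ring]).
  assert (Dm : forall t, J t -> deriv_within J m t (- 2 * m t * (m t - 1))).
  { intros t Jt. destruct (H t Jt) as (_ & h1 & h2 & h3). fold (m t) in h1, h2, h3.
    set (mt := m t) in *. assert (E : mt = 1 + discr (a t) (b t) (d t)) by reflexivity.
    clearbody mt. unfold m, discr in *. eapply deriv_within_conv; [deriv_tac|].
    cbv beta. rewrite E. ring. }
  (* [u = / m], the squared curvature, satisfies the linear equation [u' = 2 (1 - u)]. *)
  assert (Em : forall t, J t -> (1 - / m t) * exp (2 * t) = 1 - / m 0).
  { intros t Jt. transitivity ((1 - / m 0) * exp (2 * 0));
      [|rewrite Rmult_0_r, exp_0; ring].
    apply (deriv_within_zero J (fun t => (1 - / m t) * exp (2 * t))); try assumption.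
    intros x Jx. assert (hm := proj1 (H x Jx)). fold (m x) in hm. assert (h := Dm x Jx).
    assert (h' := Dexp x).
    eapply deriv_within_conv; [deriv_tac; lra|]. cbv beta. field. lra. }
  assert (E0 : a0 ^ 2 * m 0 = a0 ^ 2 + dl) by (unfold m, dl, discr; ring).
  assert (hm0 : 0 < m 0) by apply (H 0 J0).
  assert (HW0 : 0 < a0 ^ 2 + dl) by (rewrite <- E0; apply Rmult_lt_0_compat; nra).
  (* The radicand of [alpha] equals a positive quantity, which confines [J] to [flow_time]. *)
  assert (Et : forall t, J t ->
    (a0 ^ 2 + dl) * exp (2 * t) - dl = (a0 ^ 2 + dl) * exp (2 * t) / m t).
  { intros t Jt. assert (hm : 0 < m t) by apply (H t Jt).
    replace dl with ((a0 ^ 2 + dl) * (1 - / m 0)) at 2 by (rewrite <- E0; field_simplify; lra).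
    rewrite <- (Em t Jt). field. lra. }
  assert (Ht : forall t, J t -> flow_time a0 dl t).
  { intros t Jt. assert (hm : 0 < m t) by apply (H t Jt).
    assert (0 < (a0 ^ 2 + dl) * exp (2 * t) / m t).
    { apply Rdiv_lt_0_compat; [|exact hm]. apply Rmult_lt_0_compat; [exact HW0 | apply exp_pos]. }
    rewrite <- Et in H0 by exact Jt. unfold flow_time. lra. }
  assert (W : forall f : R -> R, (forall t, J t -> deriv_within J f t (- m t * f t)) ->
    forall t, J t -> f t * alpha a0 dl t = a0 * f 0).
  { intros f Hf t Jt. transitivity (f 0 * alpha a0 dl 0); [|rewrite alpha_0; lra].
    apply (deriv_within_zero J (fun t => f t * alpha a0 dl t)); try assumption.
    intros x Jx. assert (h1 := Hf x Jx).
    assert (h2 := alpha_derive a0 dl J x (Ht x Jx)).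
    assert (hp := alpha_pos a0 dl x (Ht x Jx)).
    assert (hs := alpha_sqr a0 dl x (Ht x Jx)).
    assert (hm : 0 < m x) by apply (H x Jx).
    eapply deriv_within_conv; [deriv_tac|]. cbv beta.
    assert (hE := Et x Jx). rewrite exp_double in hE. rewrite <- hs in hE.
    assert (K : alpha a0 dl x ^ 2 + dl = alpha a0 dl x ^ 2 * m x).
    { rewrite hE. transitivity ((a0 ^ 2 + dl) * exp x ^ 2); [rewrite hs in *; lra | field; lra]. }
    rewrite K. field. lra. }
  intros t Jt. split; [auto|]. 
  repeat split; apply W; try exact Jt; intros x Jx; apply (H x Jx).
Qed.

Lemma icsf_unique (A B D a0 kappa : R) (I : R -> Prop) (c : R -> plane) (s0 s1 : R)
  (J' : R -> Prop) (g' : R -> R -> plane) :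
  is_interval I -> I s0 -> I s1 -> s0 <> s1 -> kappa <> 0 ->
  has_constant_curvature I c kappa -> 0 < a0 ->
  (forall s, I s -> level A B D a0 (c s)) ->
  evolves_with_constant_curvature I J' c g' ->
  forall t, J' t -> flow_time a0 (discr A B D) t /\
    forall s, I s -> level A B D (alpha a0 (discr A B D) t) (g' t s).
Proof.
  intros HI Is0 Is1 Hs01 Hk (c1 & c2 & Hc & Hcurv) Ha0 HL He t J't.
  destruct (evolution_coefficients I J' c g' s0 s1 HI Is0 Is1 Hs01 He) as (a & b & d & H).
  destruct He as [(HJi & J'0 & Hg0 & _) _].
  (* Both triples describe the initial curve with right-hand side [y], so their difference is a
     relation excluded by [curve_spans]. *)
  assert (E0 : a 0 - A / a0 = 0 /\ b 0 - B / a0 = 0 /\ d 0 - D / a0 = 0).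
  { apply (curve_spans I c c1 c2 kappa HI Hc Hk Hcurv s0 s1); auto.
    intros x Ix. destruct (H 0 J'0) as [h _]. destruct (h x Ix) as [_ h1].
    destruct (HL x Ix) as [_ h2]. rewrite Hg0 in h1 by exact Ix.
    transitivity (a 0 * (fst (c x) ^ 2 + snd (c x) ^ 2) + b 0 * fst (c x) + d 0
      - (A * (fst (c x) ^ 2 + snd (c x) ^ 2) + B * fst (c x) + D) / a0); [field; lra|].
    rewrite h1, h2. field. lra. }
  destruct E0 as (E1 & E2 & E3).
  assert (EA : a0 * a 0 = A) by (replace (a 0) with (A / a0) by lra; field; lra).
  assert (EB : a0 * b 0 = B) by (replace (b 0) with (B / a0) by lra; field; lra).
  assert (ED : a0 * d 0 = D) by (replace (d 0) with (D / a0) by lra; field; lra).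
  assert (K := coefficients_solution J' a b d a0 HJi J'0 Ha0 (fun t h => proj2 (H t h)) t J't).
  cbv zeta in K. rewrite EA, EB, ED in K. destruct K as (K & KA & KB & KD).
  split; [exact K|]. intros s Is. destruct (H t J't) as [h _].
  destruct (h s Is) as [h1 h2]. split; [exact h1|].
  set (al := alpha a0 (discr A B D) t) in *. clearbody al. rewrite <- KA, <- KB, <- KD.
  transitivity (al * (a t * (fst (g' t s) ^ 2 + snd (g' t s) ^ 2) + b t * fst (g' t s) + d t)); [ring|].
  rewrite h2. ring.
Qed.

(** * The flow from a full level curve *)

(** The two distinct points ensure that [I] has two parameters, so that derivatives relative to [I]
    are unique. *)
Lemma level_flow (A B D a0 kappa : R) (I : R -> Prop) (c : R -> plane) (T : Rbar)
  (z1 z2 : plane) :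
  is_interval I -> 0 < kappa -> has_constant_curvature I c kappa ->
  0 < a0 -> 0 < a0 ^ 2 + discr A B D ->
  same_set (trace I c) (level A B D a0) ->
  level A B D a0 z1 -> level A B D a0 z2 -> z1 <> z2 ->
  (forall t, after T t <-> flow_time a0 (discr A B D) t) ->
  exists g, is_the_ICSF I (after T) c g /\ (exists s, I s) /\
    forall t, after T t ->
      same_set (trace I (g t)) (level A B D (alpha a0 (discr A B D) t)).
Proof.
  intros HI Hk Hcc Ha0 HW HS Hz1 Hz2 Hz HT.
  destruct (proj2 (HS z1) Hz1) as [s1 [Is1 E1]].
  destruct (proj2 (HS z2) Hz2) as [s2 [Is2 E2]].
  assert (Hs : s1 <> s2) by congruence.
  assert (HL : forall s, I s -> level A B D a0 (c s)).
  { intros s Is. apply HS. exists s. auto. }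
  exists (icsf A B D a0 c).
  assert (Hcc' := Hcc). destruct Hcc' as (c1 & c2 & Hc & Hcurv).
  assert (HT1 : forall t, after T t -> flow_time a0 (discr A B D) t) by apply HT.
  assert (Htr : forall t, after T t -> same_set (trace I (icsf A B D a0 c t))
                  (level A B D (alpha a0 (discr A B D) t))).
  { intros t Ht. apply (icsf_trace A B D a0) with (J := after T); assumption. }
  assert (HTi : is_interval (after T)).
  { intros x y z Hx _ [Hz' _]. unfold after in *. destruct T as [T| |]; simpl in *; lra. }
  assert (HT0 : after T 0).
  { apply HT. unfold flow_time. rewrite Rmult_0_r, exp_0. nra. }
  split; [|split; [eauto | exact Htr]].
  split; [|split].
  - apply (icsf_evolves A B D a0 Ha0 HW I c c1 c2 s1 s2 kappa); assumption.
  - apply (icsf_not_extendable A B D a0 Ha0 HW I c c1 c2 s1 s2 kappa); try assumption.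
    apply HT.
  - intros J' g' He t J't.
    destruct (icsf_unique A B D a0 kappa I c s1 s2 J' g' HI Is1 Is2 Hs ltac:(lra) Hcc Ha0 HL
                He t J't) as [h1 h2].
    assert (Ht : after T t) by (apply HT, h1).
    split; [exact Ht|]. intros s Is. apply (Htr t Ht), h2, Is.
Qed.

(** * Time of existence and growth of [alpha] *)

Lemma flow_time_nonpos (a0 dl t : R) : dl <= 0 -> 0 < a0 ^ 2 + dl ->
  after m_infty t <-> flow_time a0 dl t.
Proof.
  intros Hdl HW. split; [|intros; exact Logic.I]. intros _. unfold flow_time.
  assert (0 < (a0 ^ 2 + dl) * exp (2 * t)) by (apply Rmult_lt_0_compat; [exact HW | apply exp_pos]).
  lra.
Qed.

Lemma exp_double_ln (W eta : R) : 0 < W -> 0 < eta -> W * exp (2 * (ln (eta / W) / 2)) = eta.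
Proof.
  intros HW He. replace (2 * (ln (eta / W) / 2)) with (ln (eta / W)) by field.
  rewrite exp_ln by (apply Rdiv_lt_0_compat; assumption). field. lra.
Qed.

Lemma exp_double_lt (W eta t : R) : 0 < W -> 0 < eta -> t < ln (eta / W) / 2 ->
  W * exp (2 * t) < eta.
Proof.
  intros HW He H. rewrite <- (exp_double_ln W eta) by assumption.
  apply Rmult_lt_compat_l; [exact HW|]. apply exp_increasing. lra.
Qed.

Lemma lt_exp_double (W eta t : R) : 0 < W -> 0 < eta ->
  ln (eta / W) / 2 < t <-> eta < W * exp (2 * t).
Proof.
  intros HW He. assert (E := exp_double_ln W eta HW He). split; intros H.
  - rewrite <- E at 1. apply Rmult_lt_compat_l; [exact HW|]. apply exp_increasing. lra.
  - rewrite <- E in H at 1. apply Rmult_lt_reg_l in H; [|exact HW].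
    apply exp_lt_inv in H. lra.
Qed.

Lemma flow_time_pos (a0 dl t : R) : 0 < dl ->
  after (ln (dl / (a0 ^ 2 + dl)) / 2) t <-> flow_time a0 dl t.
Proof.
  intros Hdl. assert (HW : 0 < a0 ^ 2 + dl) by (assert (h := pow2_ge_0 a0); lra).
  apply lt_exp_double; assumption.
Qed.

Lemma is_lim_p_infty_intro (f : R -> R) :
  (forall M, exists X, forall t, X < t -> M < f t) -> is_lim f p_infty p_infty.
Proof. intros H. apply is_lim_spec. intros M. exact (H M). Qed.

Lemma alpha_lim (a0 dl : R) : 0 < a0 ^ 2 + dl -> is_lim (alpha a0 dl) p_infty p_infty.
Proof.
  intros HW. apply is_lim_p_infty_intro. intros M.
  (* The threshold comes from [1 + 2 * t <= exp (2 * t)]. *)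
  exists ((M ^ 2 + dl) / (a0 ^ 2 + dl) / 2). intros t Ht. unfold alpha.
  apply Rle_lt_trans with (sqrt (M ^ 2)).
  - rewrite <- Rsqr_pow2, sqrt_Rsqr_abs. apply Rle_abs.
  - apply sqrt_lt_1_alt. split; [apply pow2_ge_0|].
    assert (h := exp_ineq1_le (2 * t)).
    assert (h' : (M ^ 2 + dl) / (a0 ^ 2 + dl) < exp (2 * t)) by lra.
    apply (Rmult_lt_compat_l (a0 ^ 2 + dl)) in h'; [|exact HW].
    replace ((a0 ^ 2 + dl) * ((M ^ 2 + dl) / (a0 ^ 2 + dl))) with (M ^ 2 + dl) in h'
      by (field; lra). lra.
Qed.

Lemma alpha_increasing (a0 dl t1 t2 : R) : 0 < a0 ^ 2 + dl -> flow_time a0 dl t1 ->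
  t1 < t2 -> alpha a0 dl t1 < alpha a0 dl t2.
Proof.
  intros HW H1 Ht. unfold flow_time in H1. apply sqrt_lt_1_alt. split; [lra|].
  apply Rplus_lt_compat_r, Rmult_lt_compat_l; [exact HW|]. apply exp_increasing. lra.
Qed.

(** * Hyperbolic distance through squared Euclidean distance *)

Definition sqdist (p q : plane) : R := (fst p - fst q) ^ 2 + (snd p - snd q) ^ 2.

Lemma sqdist_ge0 (p q : plane) : 0 <= sqdist p q.
Proof. apply Rplus_le_le_0_compat; apply pow2_ge_0. Qed.

Lemma hdist_eq_ratio (p q p' q' : plane) :
  halfplane p -> halfplane q -> halfplane p' -> halfplane q' ->
  sqdist p' q' * (snd p * snd q) = sqdist p q * (snd p' * snd q') ->
  hdist p' q' = hdist p q.
Proof.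
  unfold halfplane. intros Hp Hq Hp' Hq' H. unfold hdist.
  change ((fst p - fst q) ^ 2 + (snd p - snd q) ^ 2) with (sqdist p q).
  change ((fst p' - fst q') ^ 2 + (snd p' - snd q') ^ 2) with (sqdist p' q').
  assert (0 < snd p * snd q) by (apply Rmult_lt_0_compat; assumption).
  assert (0 < snd p' * snd q') by (apply Rmult_lt_0_compat; assumption).
  assert (S1 := sqrt_lt_R0 (snd p * snd q) ltac:(assumption)).
  assert (S2 := sqrt_lt_R0 (snd p' * snd q') ltac:(assumption)).
  assert (E : sqrt (sqdist p' q') * sqrt (snd p * snd q)
              = sqrt (sqdist p q) * sqrt (snd p' * snd q'))
    by (rewrite <- !sqrt_mult by (apply sqdist_ge0 || lra); f_equal; exact H).
  do 2 f_equal. apply (Rmult_eq_reg_r (2 * (sqrt (snd p * snd q) * sqrt (snd p' * snd q'))));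
    [|apply Rgt_not_eq; repeat apply Rmult_lt_0_compat; lra].
  transitivity (sqrt (sqdist p' q') * sqrt (snd p * snd q)); [field; lra|].
  rewrite E. field. lra.
Qed.

Lemma hdist_sym (p q : plane) : hdist p q = hdist q p.
Proof.
  unfold hdist. rewrite (Rmult_comm (snd p)). do 4 f_equal. ring.
Qed.

(** [be] stands for [sinh (d / 2) ^ 2], with [d] the distance; this turns conditions on distances
    into polynomial ones. *)
Lemma hdist_iff (p q : plane) (be : R) : halfplane p -> halfplane q -> 0 <= be ->
  hdist p q = 2 * arcsinh (sqrt be) <-> sqdist p q = 4 * be * (snd p * snd q).
Proof.
  unfold halfplane. intros Hp Hq Hb. unfold hdist.
  change ((fst p - fst q) ^ 2 + (snd p - snd q) ^ 2) with (sqdist p q).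
  assert (Hm : 0 < snd p * snd q) by (apply Rmult_lt_0_compat; assumption).
  assert (S1 := sqrt_lt_R0 _ Hm).
  assert (N := sqdist_ge0 p q). split; intros H.
  - assert (H1 : arcsinh (sqrt (sqdist p q) / (2 * sqrt (snd p * snd q))) = arcsinh (sqrt be))
      by lra.
    apply (f_equal sinh) in H1. rewrite !sinh_arcsinh in H1.
    assert (H2 : sqrt (sqdist p q) = 2 * (sqrt be * sqrt (snd p * snd q)))
      by (rewrite <- H1; field; lra).
    rewrite <- (pow2_sqrt _ N), H2.
    transitivity (4 * sqrt be ^ 2 * sqrt (snd p * snd q) ^ 2); [ring|].
    rewrite !pow2_sqrt by lra. ring.
  - rewrite H. do 2 f_equal.
    replace (4 * be * (snd p * snd q)) with (2 ^ 2 * (be * (snd p * snd q))) by ring.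
    rewrite sqrt_mult_alt, sqrt_pow2, (sqrt_mult be) by lra. field. lra.
Qed.

Lemma hdist_lt (p q : plane) (be eps : R) : halfplane p -> halfplane q -> 0 <= be ->
  0 < eps -> sqdist p q = 4 * be * (snd p * snd q) -> be < sinh (eps / 2) ^ 2 ->
  hdist p q < eps.
Proof.
  intros Hp Hq Hb He H Hlt. apply (hdist_iff p q be Hp Hq Hb) in H. rewrite H.
  assert (Hs : 0 < sinh (eps / 2)) by (rewrite <- sinh_0; apply sinh_lt; lra).
  assert (sqrt be < sinh (eps / 2)).
  { rewrite <- (sqrt_pow2 (sinh (eps / 2))) by lra. apply sqrt_lt_1_alt. lra. }
  apply arcsinh_lt in H0. rewrite arcsinh_sinh in H0. lra.
Qed.

(** * Isometries and circles *)

Lemma isometry_intro (f f' : plane -> plane) :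
  (forall z, halfplane z -> halfplane (f z)) ->
  (forall z, halfplane z -> halfplane (f' z)) ->
  (forall z, halfplane z -> f (f' z) = z) ->
  (forall p q, halfplane p -> halfplane q ->
     sqdist (f p) (f q) * (snd p * snd q) = sqdist p q * (snd (f p) * snd (f q))) ->
  is_isometry f.
Proof.
  intros H1 H2 H3 H4. split; [exact H1|]. split.
  - intros p q Hp Hq. apply hdist_eq_ratio; auto.
  - intros q Hq. exists (f' q). auto.
Qed.

Lemma isometry_comp (f h : plane -> plane) :
  is_isometry f -> is_isometry h -> is_isometry (fun z => f (h z)).
Proof.
  intros (F1 & F2 & F3) (H1 & H2 & H3). split; [auto|]. split.
  - intros p q Hp Hq. rewrite F2, H2; auto.
  - intros q Hq. destruct (F3 q Hq) as [p [Hp <-]]. destruct (H3 p Hp) as [r [Hr <-]].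
    exists r. auto.
Qed.

Definition similarity (sg lam mu : R) (z : plane) : plane :=
  (sg * lam * fst z + mu, lam * snd z).

Definition inversion (z : plane) : plane :=
  (fst z / (fst z ^ 2 + snd z ^ 2), snd z / (fst z ^ 2 + snd z ^ 2)).

Lemma similarity_cancel (sg lam mu : R) (z : plane) : sg ^ 2 = 1 -> 0 < lam ->
  similarity sg lam mu (similarity sg (/ lam) (- sg * mu / lam) z) = z.
Proof.
  intros Hs Hl. destruct z as [x y]. unfold similarity. cbn [fst snd]. f_equal; [|field; lra].
  transitivity (sg ^ 2 * x + (1 - sg ^ 2) * mu); [field; lra|]. rewrite Hs. ring.
Qed.

Lemma similarity_isometry (sg lam mu : R) : sg ^ 2 = 1 -> 0 < lam ->
  is_isometry (similarity sg lam mu).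
Proof.
  intros Hs Hl. apply isometry_intro with (similarity sg (/ lam) (- sg * mu / lam)).
  - intros z Hz. apply Rmult_lt_0_compat; assumption.
  - intros z Hz. apply Rmult_lt_0_compat; [apply Rinv_0_lt_compat|]; assumption.
  - intros z _. apply similarity_cancel; assumption.
  - intros p q _ _. unfold similarity, sqdist. cbn [fst snd].
    transitivity ((sg ^ 2 * (fst p - fst q) ^ 2 + (snd p - snd q) ^ 2)
                  * (lam ^ 2 * (snd p * snd q))); [ring|]. rewrite Hs. ring.
Qed.

Lemma norm_pos (z : plane) : halfplane z -> 0 < fst z ^ 2 + snd z ^ 2.
Proof. unfold halfplane. intros H. nra. Qed.

Lemma inversion_halfplane (z : plane) : halfplane z -> halfplane (inversion z).
Proof. intros H. apply Rdiv_lt_0_compat; [exact H | apply norm_pos, H]. Qed.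

Lemma inversion_norm (z : plane) : halfplane z ->
  fst (inversion z) ^ 2 + snd (inversion z) ^ 2 = / (fst z ^ 2 + snd z ^ 2).
Proof. intros H. apply norm_pos in H. unfold inversion. cbn [fst snd]. field. lra. Qed.

Lemma inversion_invol (z : plane) : halfplane z -> inversion (inversion z) = z.
Proof.
  intros H. assert (N := inversion_norm z H). unfold inversion at 1. rewrite N.
  apply norm_pos in H. destruct z as [x y]. unfold inversion. cbn [fst snd] in *.
  f_equal; field; lra.
Qed.

Lemma inversion_isometry : is_isometry inversion.
Proof.
  apply isometry_intro with inversion;
    [exact inversion_halfplane | exact inversion_halfplane | exact inversion_invol |].
  intros p q Hp Hq. apply norm_pos in Hp, Hq. unfold inversion, sqdist. cbn [fst snd].
  field. lra.
Qed.

Lemma image_eq (f f' : plane -> plane) (S S' : pset) :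
  (forall z, S z -> S' (f z)) -> (forall z, S' z -> S (f' z)) ->
  (forall z, S' z -> f (f' z) = z) ->
  same_set (image f S) S'.
Proof.
  intros H1 H2 H3 z. split.
  - intros [p [Hp <-]]. auto.
  - intros Hz. exists (f' z). auto.
Qed.

Lemma image_same (f : plane -> plane) (S S' : pset) :
  same_set S S' -> same_set (image f S) (image f S').
Proof. intros H z. split; intros [p [Hp E]]; exists p; split; auto; apply H, Hp. Qed.

Lemma same_set_trans (S1 S2 S3 : pset) : same_set S1 S2 -> same_set S2 S3 -> same_set S1 S3.
Proof. intros H1 H2 z. rewrite (H1 z). apply H2. Qed.

Lemma same_set_sym (S1 S2 : pset) : same_set S1 S2 -> same_set S2 S1.
Proof. intros H z. symmetry. apply H. Qed.

Lemma image_similarity_level (sg lam mu A B D al : R) (S' : pset) : sg ^ 2 = 1 -> 0 < lam ->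
  (forall z, level A B D al (similarity sg (/ lam) (- sg * mu / lam) z) <-> S' z) ->
  same_set (image (similarity sg lam mu) (level A B D al)) S'.
Proof.
  intros Hs Hl H. apply image_eq with (similarity sg (/ lam) (- sg * mu / lam)).
  - intros z Hz. apply H. replace (similarity _ _ _ (similarity sg lam mu z)) with z; [exact Hz|].
    destruct z as [x y]. unfold similarity. cbn [fst snd]. f_equal; [|field; lra].
    transitivity (sg ^ 2 * x); [rewrite Hs; ring | field; lra].
  - intros z Hz. apply H, Hz.
  - intros z _. apply similarity_cancel; assumption.
Qed.

Lemma same_set_level (A B D al r : R) (P : plane -> Prop) : r <> 0 ->
  (forall z, P z <-> r * (A * (fst z ^ 2 + snd z ^ 2) + B * fst z + D - al * snd z) = 0) ->
  same_set (fun z => halfplane z /\ P z) (level A B D al).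
Proof.
  intros Hr H z. unfold level. rewrite H. split; intros [h1 h2]; (split; [exact h1|]).
  - apply Rmult_integral in h2. destruct h2; lra.
  - rewrite h2. ring.
Qed.

(** [1 + 2 * be] is the hyperbolic cosine of the radius, so the Euclidean center has height [snd p]
    times that cosine. *)
Lemma circle_level (p : plane) (be : R) : halfplane p -> 0 <= be ->
  same_set (hyperbolic_circle p (2 * arcsinh (sqrt be)))
    (level 1 (-2 * fst p) (fst p ^ 2 + snd p ^ 2) (2 * snd p * (1 + 2 * be))).
Proof.
  intros Hp Hb z. unfold hyperbolic_circle, level.
  split; intros [Hz H]; (split; [exact Hz|]).
  - apply hdist_iff in H; try assumption. unfold sqdist in H. lra.
  - apply hdist_iff; try assumption. unfold sqdist. lra.
Qed.

Lemma hyperbolic_radius (r : R) : 0 < r ->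
  0 < sinh (r / 2) ^ 2 /\ r = 2 * arcsinh (sqrt (sinh (r / 2) ^ 2)).
Proof.
  intros Hr. assert (Hs : 0 < sinh (r / 2)) by (rewrite <- sinh_0; apply sinh_lt; lra).
  split; [nra|]. rewrite sqrt_pow2, arcsinh_sinh by lra. field.
Qed.

Lemma arcsinh_sqrt_pos (be : R) : 0 < be -> 0 < 2 * arcsinh (sqrt be).
Proof.
  intros H. assert (K := arcsinh_lt 0 (sqrt be) (sqrt_lt_R0 _ H)). rewrite arcsinh_0 in K. lra.
Qed.

Lemma isometry_image_circle (f : plane -> plane) (p : plane) (r : R) :
  is_isometry f -> halfplane p ->
  same_set (image f (hyperbolic_circle p r)) (hyperbolic_circle (f p) r).
Proof.
  intros (F1 & F2 & F3) Hp z. split.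
  - intros [q [[Hq H] <-]]. split; [auto|]. rewrite F2; assumption.
  - intros [Hz H]. destruct (F3 z Hz) as [q [Hq <-]]. exists q.
    rewrite F2 in H by assumption. repeat split; assumption.
Qed.

(** * The flow of hyperbolic circles *)

Lemma backward_m_infty (P : R -> Prop) (X : R) :
  (forall t, t < X -> P t) -> backward m_infty P.
Proof. intros H. exists X. intros t Ht _. apply H, Ht. Qed.

Lemma circle_case (I : R -> Prop) (c : R -> plane) (kappa : R) (p : plane) :
  is_interval I -> 0 < kappa -> has_constant_curvature I c kappa ->
  halfplane p -> is_hyperbolic_circle p (trace I c) ->
  exists (T : Rbar) (g : R -> R -> plane),
    is_the_ICSF I (after T) c g /\
    (forall t, after T t -> is_hyperbolic_circle p (trace I (g t))) /\
    expanding normalized_circle (after T) (fun t => trace I (g t)) /\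
    converges_to (backward T) (fun t => trace I (g t)) (fun q => q = p).
Proof.
  intros HI Hk Hcc Hp [r [Hr HS]].
  destruct (hyperbolic_radius r Hr) as [Hb0 Er]. set (be0 := sinh (r / 2) ^ 2) in *.
  clearbody be0. subst r. assert (Hy : 0 < snd p) by exact Hp.
  set (A := 1) in *. set (B := -2 * fst p). set (D := fst p ^ 2 + snd p ^ 2).
  set (a0 := 2 * snd p * (1 + 2 * be0)).
  assert (HS' : same_set (trace I c) (level A B D a0))
    by (apply (same_set_trans _ _ _ HS), circle_level; [exact Hp | lra]).
  assert (Ed : discr A B D = - (2 * snd p) ^ 2) by (unfold discr, A, B, D; ring).
  assert (Ha0 : 2 * snd p < a0) by (unfold a0; nra).
  assert (HW : 0 < a0 ^ 2 + discr A B D) by (rewrite Ed; nra).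
  assert (HT : forall t, after m_infty t <-> flow_time a0 (discr A B D) t).
  { intros t. apply flow_time_nonpos; [|exact HW]. rewrite Ed.
    assert (h := pow2_ge_0 (2 * snd p)). lra. }
  (* The two points of the circle on the vertical line through [p]: the squared factor is [(cosh (r
     / 2) + e sinh (r / 2)) ^ 2 = exp (e r)], where [r] is the radius. *)
  assert (Hpt : forall e, e ^ 2 = 1 ->
    level A B D a0 (fst p, snd p * (sqrt be0 * e + sqrt (1 + be0)) ^ 2)).
  { intros e He.
    assert (Q1 : sqrt be0 ^ 2 = be0) by (apply pow2_sqrt; lra).
    assert (Q2 : sqrt (1 + be0) ^ 2 = 1 + be0) by (apply pow2_sqrt; lra).
    assert (Q3 : sqrt be0 < sqrt (1 + be0)) by (apply sqrt_lt_1_alt; lra).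
    assert (Q4 := sqrt_lt_R0 _ Hb0).
    set (u := sqrt be0) in *. set (v := sqrt (1 + be0)) in *.
    assert (Hne : 0 < u * e + v) by nra.
    split; unfold halfplane; cbn [fst snd].
    - apply Rmult_lt_0_compat; [exact Hy | nra].
    - unfold A, B, D, a0. rewrite <- Q1.
      assert (Ev : v ^ 2 = 1 + u ^ 2) by lra.
      assert (E : (u * e + v) ^ 4 + 1 = 2 * (1 + 2 * u ^ 2) * (u * e + v) ^ 2).
      { replace ((u * e + v) ^ 4) with ((u ^ 2 * e ^ 2 + v ^ 2 + 2 * u * e * v) ^ 2) by ring.
        replace ((u * e + v) ^ 2) with (u ^ 2 * e ^ 2 + v ^ 2 + 2 * u * e * v) by ring.
        rewrite He.
        transitivity ((u ^ 2 * 1 + v ^ 2) ^ 2 + 4 * (u ^ 2 * 1 + v ^ 2) * u * e * v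
          + 4 * u ^ 2 * e ^ 2 * v ^ 2 + 1); [ring|].
        rewrite He, Ev. ring. }
      transitivity (snd p ^ 2 * ((u * e + v) ^ 4 + 1)); [ring|]. rewrite E. ring. }
  destruct (level_flow A B D a0 kappa I c m_infty _ _ HI Hk Hcc ltac:(lra) HW HS'
    (Hpt 1 ltac:(ring)) (Hpt (-1) ltac:(ring))) as (g & Hg & [s Is] & Htr); [|exact HT|].
  { intros E. injection E as E.
    assert (Q2 := sqrt_lt_R0 (1 + be0) ltac:(lra)). assert (Q4 := sqrt_lt_R0 _ Hb0).
    apply Rmult_eq_reg_l in E; [|lra]. nra. }
  set (dl := discr A B D) in *.
  (* [sinh (r / 2) ^ 2] for the radius [r] at time [t], solved from [circle_level]. *)
  set (be := fun t => (alpha a0 dl t / (2 * snd p) - 1) / 2).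
  assert (Ebe : forall t, alpha a0 dl t = 2 * snd p * (1 + 2 * be t))
    by (intros t; unfold be; field; lra).
  assert (Has : forall t, alpha a0 dl t ^ 2 = (2 * snd p) ^ 2 + (a0 ^ 2 + dl) * exp (2 * t)).
  { intros t. rewrite alpha_sqr, exp_double by (apply HT; exact Logic.I). rewrite Ed at 2. ring. }
  assert (Hexp : forall t, 0 < (a0 ^ 2 + dl) * exp (2 * t))
    by (intros t; apply Rmult_lt_0_compat; [exact HW | apply exp_pos]).
  assert (Hal : forall t, 2 * snd p < alpha a0 dl t).
  { intros t. assert (0 < alpha a0 dl t) by (apply alpha_pos, HT; exact Logic.I).
    specialize (Has t). specialize (Hexp t). nra. }
  assert (Hbe : forall t, 0 < be t).
  { intros t. specialize (Hal t). rewrite Ebe in Hal. nra. }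
  assert (Hcirc : forall t,
    same_set (trace I (g t)) (hyperbolic_circle p (2 * arcsinh (sqrt (be t))))).
  { intros t. apply (same_set_trans _ _ _ (Htr t Logic.I)). rewrite Ebe.
    apply same_set_sym, circle_level; [exact Hp | left; apply Hbe]. }
  exists m_infty, g. split; [exact Hg|]. split; [|split].
  - intros t _. exists (2 * arcsinh (sqrt (be t))).
    split; [apply arcsinh_sqrt_pos, Hbe | apply Hcirc].
  - assert (Hf : is_isometry (similarity 1 (/ snd p) (- fst p / snd p)))
      by (apply similarity_isometry; [ring | apply Rinv_0_lt_compat, Hy]).
    exists (similarity 1 (/ snd p) (- fst p / snd p)). split; [exact Hf|].
    exists (fun t => 2 * arcsinh (sqrt (be t))). split; [|split].
    + intros t _. split; [apply arcsinh_sqrt_pos, Hbe|].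
      apply (same_set_trans _ _ _ (image_same _ _ _ (Hcirc t))).
      assert (Hc := isometry_image_circle _ p (2 * arcsinh (sqrt (be t))) Hf Hp).
      replace (similarity 1 (/ snd p) (- fst p / snd p) p) with (0, 1) in Hc; [exact Hc|].
      unfold similarity. f_equal; field; lra.
    + intros t1 t2 _ _ Ht. apply Rmult_lt_compat_l; [lra|]. apply arcsinh_lt, sqrt_lt_1_alt.
      split; [left; apply Hbe|].
      assert (h := alpha_increasing a0 dl t1 t2 HW (proj1 (HT t1) Logic.I) Ht).
      rewrite !Ebe in h. nra.
    + apply is_lim_p_infty_intro. intros M.
      assert (L := alpha_lim a0 dl HW). apply is_lim_spec in L.
      destruct (L (2 * snd p * (1 + 2 * sinh (M / 2) ^ 2))) as [X HX]. exists X. intros t Ht.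
      specialize (HX t Ht). rewrite Ebe in HX.
      assert (Hs : sinh (M / 2) ^ 2 < be t) by nra.
      assert (K : sinh (M / 2) < sqrt (be t)).
      { apply Rle_lt_trans with (sqrt (sinh (M / 2) ^ 2)).
        - rewrite <- Rsqr_pow2, sqrt_Rsqr_abs. apply Rle_abs.
        - apply sqrt_lt_1_alt. split; [apply pow2_ge_0 | exact Hs]. }
      apply arcsinh_lt in K. rewrite arcsinh_sinh in K. lra.
  - intros eps He.
    set (W := a0 ^ 2 + dl) in *.
    assert (Hs : 0 < sinh (eps / 2)) by (rewrite <- sinh_0; apply sinh_lt; lra).
    (* As [16 * snd p ^ 2 * (be t + be t ^ 2) = (a0 ^ 2 + dl) * exp (2 * t)], this bound on [t]
       forces [be t < sinh (eps / 2) ^ 2]. *)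
    apply backward_m_infty with (ln (4 * snd p * sinh (eps / 2) ^ 2 * (4 * snd p) / W) / 2).
    intros t Ht.
    assert (Het : 0 < 4 * snd p * sinh (eps / 2) ^ 2 * (4 * snd p))
      by (assert (h := pow_lt _ 2 Hs); apply Rmult_lt_0_compat; [apply Rmult_lt_0_compat|]; lra).
    apply exp_double_lt in Ht; [|exact HW | exact Het].
    assert (Hd : forall q, trace I (g t) q -> hdist q p < eps).
    { intros q Hq. apply Hcirc in Hq. destruct Hq as [_ Hq]. rewrite hdist_sym, Hq.
      assert (K : be t < sinh (eps / 2) ^ 2).
      { specialize (Has t). rewrite Ebe in Has. specialize (Hbe t).
        apply (Rmult_lt_reg_l (16 * snd p ^ 2)); [nra|]. nra. }
      assert (K' : sqrt (be t) < sinh (eps / 2)).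
      { rewrite <- (sqrt_pow2 (sinh (eps / 2))) by lra. apply sqrt_lt_1_alt.
        split; [left; apply Hbe | exact K]. }
      apply arcsinh_lt in K'. rewrite arcsinh_sinh in K'. lra. }
    split.
    + intros q Hq. exists p. auto.
    + intros q ->. exists (g t s). assert (Hq : trace I (g t) (g t s)) by (exists s; auto). auto.
Qed.

(** * Horocycles *)

Lemma horocycle_level (b rho : R) :
  same_set (fun z => halfplane z /\ ecircle (b, rho) rho z) (level 1 (-2 * b) (b ^ 2) (2 * rho)).
Proof.
  apply (same_set_level _ _ _ _ 1); [lra|]. intros z. unfold ecircle. cbn [fst snd].
  split; intros H; lra.
Qed.

Lemma horizontal_level (h : R) : 0 < h ->
  same_set (fun z => snd z = h) (level 0 0 1 (/ h)).
Proof.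
  intros Hh z. unfold level, halfplane. split.
  - intros ->. split; [exact Hh | field; lra].
  - intros [_ H]. apply (Rmult_eq_reg_l (/ h)); [|apply Rinv_neq_0_compat; lra].
    rewrite Rinv_l by lra. lra.
Qed.

Lemma image_inversion_level (A B D al : R) :
  same_set (image inversion (level A B D al)) (level D B A al).
Proof.
  assert (K : forall A' B' D' z, level A' B' D' al z -> level D' B' A' al (inversion z)).
  { intros A' B' D' z [Hz H]. split; [apply inversion_halfplane, Hz|].
    rewrite inversion_norm by exact Hz. apply norm_pos in Hz. unfold inversion. cbn [fst snd].
    apply (Rmult_eq_reg_r (fst z ^ 2 + snd z ^ 2)); [|lra]. field_simplify; lra. }
  apply image_eq with inversion; [apply K | apply K |].
  intros z [Hz _]. apply inversion_invol, Hz.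
Qed.

(** Collects what the flow argument needs, so that circles and horizontal lines are treated alike.
    [al] is the Euclidean diameter of the circle or the inverse height of the line, so in both cases
    [al] tending to 0 is convergence to the ideal point. *)
Lemma horocycle_is_level (z : ideal_point) (S : pset) :
  is_horocycle z S -> exists A B D a0,
    discr A B D = 0 /\ 0 < a0 /\ same_set S (level A B D a0) /\
    (exists z1 z2, level A B D a0 z1 /\ level A B D a0 z2 /\ z1 <> z2) /\
    (forall al S', 0 < al -> same_set S' (level A B D al) -> is_horocycle z S') /\
    (exists f, is_isometry f /\ forall al, 0 < al ->
       same_set (image f (level A B D al))
         (fun p => halfplane p /\ ecircle (0, al / 2) (al / 2) p)) /\
    match z with
    | Ideal b => forall al p, 0 < al -> level A B D al p -> enorm (fst p - b, snd p) <= al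
    | Ideal_infty => forall al p, 0 < al -> level A B D al p -> / al <= enorm p
    end.
Proof.
  destruct z as [b|].
  - intros [rho [Hr HS]]. exists 1, (-2 * b), (b ^ 2), (2 * rho).
    split; [unfold discr; ring|]. split; [lra|].
    split; [apply (same_set_trans _ _ _ HS), horocycle_level|]. split; [|split; [|split]].
    + exists (b, 2 * rho), (b + rho, rho).
      split; [|split]; [split; unfold halfplane; cbn [fst snd]; [lra | ring]..|].
      intros E. injection E as E1 E2. lra.
    + intros al S' Hal H. exists (al / 2). split; [lra|].
      apply (same_set_trans _ _ _ H), same_set_sym.
      replace (level 1 (-2 * b) (b ^ 2) al) with (level 1 (-2 * b) (b ^ 2) (2 * (al / 2)))
        by (f_equal; field).
      apply horocycle_level.
    + exists (similarity 1 1 (- b)). split; [apply similarity_isometry; lra|].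
      intros al Hal. apply image_similarity_level; [ring | lra|].
      intros p. unfold level, halfplane, ecircle, similarity. cbn [fst snd].
      rewrite Rinv_1. replace (-1 * - b / 1) with b by field.
      split; intros [h1 h2]; split; lra.
    + intros al p Hal [Hy H]. unfold halfplane in Hy. unfold enorm. cbn [fst snd].
      rewrite <- (sqrt_pow2 al) by lra. apply sqrt_le_1_alt.
      assert (E : (fst p - b) ^ 2 + snd p ^ 2 = al * snd p) by lra.
      assert (h0 := pow2_ge_0 (fst p - b)).
      assert (Hle : snd p <= al).
      { apply (Rmult_le_reg_r (snd p)); [exact Hy|]. lra. }
      apply (Rmult_le_compat_l al) in Hle; [lra|lra].
  - intros [h [Hh HS]]. exists 0, 0, 1, (/ h).
    split; [unfold discr; ring|]. split; [apply Rinv_0_lt_compat, Hh|].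
    split; [apply (same_set_trans _ _ _ HS), horizontal_level, Hh|]. split; [|split; [|split]].
    + exists (0, h), (1, h).
      split; [|split]; [apply horizontal_level; [exact Hh | reflexivity]..|].
      intros E. injection E as E1. lra.
    + intros al S' Hal H. exists (/ al). split; [apply Rinv_0_lt_compat, Hal|].
      apply (same_set_trans _ _ _ H), same_set_sym.
      assert (K := horizontal_level (/ al) (Rinv_0_lt_compat _ Hal)).
      rewrite Rinv_inv in K. exact K.
    (* Inversion exchanges [A] and [D], and so takes horizontal lines to circles tangent at the
       origin. *)
    + exists inversion. split; [exact inversion_isometry|].
      intros al Hal.
      apply (same_set_trans _ _ _ (image_inversion_level 0 0 1 al)), same_set_sym.
      apply (same_set_trans _ _ _ (horocycle_level 0 (al / 2))). intros p.
      unfold level. split; intros [h1 h2]; split; try exact h1; lra.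
    + intros al p Hal [Hy H]. unfold halfplane in Hy.
      assert (E : snd p = / al) by (apply (Rmult_eq_reg_l al); [rewrite Rinv_r by lra; lra | lra]).
      rewrite <- E. unfold enorm. rewrite <- (sqrt_pow2 (snd p)) at 1 by lra.
      apply sqrt_le_1_alt. assert (h0 := pow2_ge_0 (fst p)). lra.
Qed.

Lemma horocycle_case (I : R -> Prop) (c : R -> plane) (kappa : R) (z : ideal_point) :
  is_interval I -> 0 < kappa -> has_constant_curvature I c kappa ->
  is_horocycle z (trace I c) ->
  exists (T : Rbar) (g : R -> R -> plane),
    is_the_ICSF I (after T) c g /\
    (forall t, after T t -> is_horocycle z (trace I (g t))) /\
    expanding normalized_horocycle (after T) (fun t => trace I (g t)) /\
    converges_to_ideal (backward T) (fun t => trace I (g t)) z.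
Proof.
  intros HI Hk Hcc Hz.
  destruct (horocycle_is_level z _ Hz)
    as (A & B & D & a0 & Ed & Ha0 & HS & (z1 & z2 & Hz1 & Hz2 & Hne) & Hhor & [f [Hf Himg]] & Hlim).
  assert (HW : 0 < a0 ^ 2 + discr A B D) by (rewrite Ed; nra).
  assert (HT : forall t, after m_infty t <-> flow_time a0 (discr A B D) t)
    by (intros t; apply flow_time_nonpos; [lra | exact HW]).
  destruct (level_flow A B D a0 kappa I c m_infty z1 z2 HI Hk Hcc Ha0 HW HS Hz1 Hz2 Hne HT)
    as (g & Hg & _ & Htr).
  set (dl := discr A B D) in *.
  assert (Hal : forall t, 0 < alpha a0 dl t) by (intros t; apply alpha_pos, HT; exact Logic.I).
  assert (Has : forall t, alpha a0 dl t ^ 2 = (a0 ^ 2 + dl) * exp (2 * t)).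
  { intros t. rewrite alpha_sqr, exp_double by (apply HT; exact Logic.I). lra. }
  assert (Hsmall : forall eta, 0 < eta -> backward m_infty (fun t => alpha a0 dl t < eta)).
  { intros eta He. apply backward_m_infty with (ln (eta ^ 2 / (a0 ^ 2 + dl)) / 2).
    intros t Ht. apply exp_double_lt in Ht; [|exact HW | nra]. rewrite <- Has in Ht.
    specialize (Hal t). nra. }
  exists m_infty, g. split; [exact Hg|]. split; [|split].
  - intros t Ht. apply (Hhor (alpha a0 dl t)); auto.
  - exists f. split; [exact Hf|]. exists (fun t => alpha a0 dl t / 2). split; [|split].
    + intros t Ht. specialize (Hal t). split; [lra|].
      apply (same_set_trans _ _ _ (image_same _ _ _ (Htr t Ht))), Himg, Hal.
    + intros t1 t2 _ _ Ht.
      assert (h := alpha_increasing a0 dl t1 t2 HW (proj1 (HT t1) Logic.I) Ht). lra.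
    + assert (L := alpha_lim a0 dl HW). apply is_lim_spec in L.
      apply is_lim_p_infty_intro. intros M. destruct (L (2 * M)) as [X HX].
      exists X. intros t Ht. specialize (HX t Ht). lra.
  - destruct z as [b|].
    + intros eps He. generalize (Hsmall eps He). apply filter_imp. intros t Ht p Hp.
      apply (Htr t Logic.I) in Hp. apply Rle_lt_trans with (2 := Ht). apply Hlim; auto.
    + intros M. assert (HM : 0 < / (Rabs M + 1))
        by (apply Rinv_0_lt_compat; assert (h := Rabs_pos M); lra).
      generalize (Hsmall _ HM). apply filter_imp. intros t Ht p Hp.
      apply (Htr t Logic.I) in Hp.
      apply Rlt_le_trans with (/ alpha a0 dl t); [|apply Hlim; auto].
      apply Rlt_trans with (Rabs M + 1); [assert (h := Rle_abs M); lra|].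
      rewrite <- (Rinv_inv (Rabs M + 1)). apply Rinv_lt_contravar; [|exact Ht].
      apply Rmult_lt_0_compat; [apply Hal | exact HM].
Qed.

(** * Equidistant lines *)

Lemma image_comp (f h : plane -> plane) (S S1 S2 : pset) :
  same_set (image h S) S1 -> same_set (image f S1) S2 ->
  same_set (image (fun z => f (h z)) S) S2.
Proof.
  intros H1 H2 z. rewrite <- (H2 z). split.
  - intros [p [Hp <-]]. exists (h p). split; [apply H1; exists p; auto | reflexivity].
  - intros [q [Hq <-]]. apply H1 in Hq. destruct Hq as [p [Hp <-]]. exists p. auto.
Qed.

(** Squared radius minus squared center height is [s ^ 2 * dl] whatever [al] is: all these circles
    share their ideal points. *)
Lemma centered_circle_level (s al dl : R) : 0 <= al ^ 2 + dl ->
  same_set (level 1 0 (- s ^ 2 * dl) (2 * s * al))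
    (fun z => halfplane z /\ ecircle (0, s * al) (s * sqrt (al ^ 2 + dl)) z).
Proof.
  intros H z. unfold level, ecircle. cbn [fst snd].
  rewrite Rpow_mult_distr, pow2_sqrt by exact H.
  split; intros [h1 h2]; split; try exact h1; lra.
Qed.

(** [level A B D al], [al > 0], are the equidistant lines on one side of the
    geodesic [level A B D 0]; [s * al] is the height of the Euclidean center of
    the normalized representative. *)
Definition equidistant_family (z1 z2 : ideal_point) (A B D s : R) : Prop :=
  0 < discr A B D /\ 0 < s /\ is_geodesic z1 z2 (level A B D 0) /\
  (forall al, 0 < al ->
     is_equidistant_line z1 z2 (level A B D al) /\
     exists p q, level A B D al p /\ level A B D al q /\ p <> q) /\
  exists f, is_isometry f /\ forall al, 0 < al ->
    same_set (image f (level A B D al))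
      (fun z => halfplane z /\ ecircle (0, s * al) (s * sqrt (al ^ 2 + discr A B D)) z).

(** [sg] selects the side of the geodesic: the Euclidean center has height [sg * al / 2]. *)
Lemma equidistant_family_arcs (a b sg : R) : a <> b -> sg = 1 \/ sg = -1 ->
  equidistant_family (Ideal a) (Ideal b) sg (- sg * (a + b)) (sg * (a * b)) (1 / 2).
Proof.
  intros Hab Hsg. assert (Hs2 : sg ^ 2 = 1) by (destruct Hsg as [-> | ->]; ring).
  assert (Hs0 : sg <> 0) by lra.
  assert (Ed : discr sg (- sg * (a + b)) (sg * (a * b)) = (a - b) ^ 2).
  { transitivity (sg ^ 2 * (a - b) ^ 2); [unfold discr; ring | rewrite Hs2; ring]. }
  assert (Hd : 0 < (a - b) ^ 2) by (apply pow2_gt_0; lra).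
  unfold equidistant_family. rewrite Ed.
  split; [exact Hd|]. split; [lra|]. split; [|split].
  - split; [exact Hab|]. exists ((a + b) / 2), ((a - b) / 2).
    split; [unfold ecircle; cbn [fst snd]; field|]. split; [unfold ecircle; cbn [fst snd]; field|].
    apply same_set_sym, (same_set_level _ _ _ _ sg); [exact Hs0|].
    intros z. unfold ecircle. cbn [fst snd].
    replace (sg * _) with (sg ^ 2 * ((fst z ^ 2 + snd z ^ 2) - (a + b) * fst z + a * b)) by ring.
    rewrite Hs2. split; intros H; lra.
  - intros al Hal. set (rho := sqrt (al ^ 2 + (a - b) ^ 2) / 2).
    assert (Hr : rho ^ 2 = (al ^ 2 + (a - b) ^ 2) / 4).
    { unfold rho. transitivity (sqrt (al ^ 2 + (a - b) ^ 2) ^ 2 / 4); [field|].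
      rewrite pow2_sqrt by nra. reflexivity. }
    assert (Hc : (sg * al / 2) ^ 2 = al ^ 2 / 4).
    { transitivity (sg ^ 2 * al ^ 2 / 4); [field | rewrite Hs2; field]. }
    split.
    + split; [exact Hab|]. exists ((a + b) / 2), (sg * al / 2), rho.
      unfold ecircle. cbn [fst snd]. rewrite Hr. split; [nra|].
      replace ((0 - sg * al / 2) ^ 2) with ((sg * al / 2) ^ 2) by ring. rewrite Hc.
      split; [field|]. split; [field|].
      apply same_set_sym, (same_set_level _ _ _ _ sg); [exact Hs0|]. intros z.
      assert (E : sg * (sg * (fst z ^ 2 + snd z ^ 2) + - sg * (a + b) * fst z + sg * (a * b)
                        - al * snd z)
        = sg ^ 2 * ((fst z ^ 2 + snd z ^ 2) - (a + b) * fst z + a * b) - sg * al * snd z) by ring.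
      rewrite E, Hs2. replace ((snd z - sg * al / 2) ^ 2)
        with (snd z ^ 2 - sg * al * snd z + (sg * al / 2) ^ 2) by field.
      rewrite Hc. split; intros H; lra.
    (* The intersection with the ray [x = (a + b) / 2 + e y]; its height is the positive root of a
       quadratic equation. The values 0 and 1 of [e] give two different points. *)
    + assert (K : forall e, level sg (- sg * (a + b)) (sg * (a * b)) al
          ((a + b) / 2 + e * ((sg * al / 2 + sqrt ((sg * al / 2) ^ 2 + (1 + e ^ 2) * (a - b) ^ 2 / 4))
              / (1 + e ^ 2)),
           (sg * al / 2 + sqrt ((sg * al / 2) ^ 2 + (1 + e ^ 2) * (a - b) ^ 2 / 4)) / (1 + e ^ 2))).
      { intros e. set (cc := sg * al / 2) in *. set (r := 1 + e ^ 2).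
        assert (Hr1 : 0 < r) by (unfold r; nra).
        assert (Hp : 0 < r * (a - b) ^ 2 / 4) by nra.
        assert (Hq : 0 <= cc ^ 2 + r * (a - b) ^ 2 / 4) by nra.
        assert (Q := pow2_sqrt _ Hq).
        assert (Hlt : - cc < sqrt (cc ^ 2 + r * (a - b) ^ 2 / 4)).
        { apply Rle_lt_trans with (sqrt ((- cc) ^ 2)).
          - rewrite <- Rsqr_pow2, sqrt_Rsqr_abs. apply Rle_abs.
          - apply sqrt_lt_1_alt. split; [apply pow2_ge_0 | nra]. }
        set (R0 := sqrt (cc ^ 2 + r * (a - b) ^ 2 / 4)) in *. clearbody R0.
        split; unfold halfplane; cbn [fst snd]; [apply Rdiv_lt_0_compat; lra|].
        set (y := (cc + R0) / r).
        assert (Ey : r * y ^ 2 - 2 * cc * y = (a - b) ^ 2 / 4).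
        { apply (Rmult_eq_reg_l r); [|lra].
          transitivity (R0 ^ 2 - cc ^ 2); [unfold y; field; lra|]. rewrite Q. field. }
        transitivity (sg * (r * y ^ 2 - (a - b) ^ 2 / 4)); [unfold r; field|].
        rewrite <- Ey. transitivity (sg ^ 2 * al * y); [unfold cc; field | rewrite Hs2; ring]. }
      eexists _, _. split; [exact (K 0)|]. split; [exact (K 1)|].
      intros E. apply (f_equal fst) in E. cbn [fst] in E.
      destruct (K 1) as [Hp _]. unfold halfplane in Hp. cbn [snd] in Hp. lra.
  - assert (Hn : forall al, 0 < al -> 0 <= al ^ 2 + (a - b) ^ 2) by (intros; nra).
    destruct Hsg as [-> | ->].
    + exists (similarity 1 1 (- ((a + b) / 2))). split; [apply similarity_isometry; lra|].
      intros al Hal. apply image_similarity_level; [lra | lra |].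
      intros z. rewrite <- (centered_circle_level (1 / 2) al ((a - b) ^ 2) (Hn al Hal) z).
      unfold level, halfplane, similarity. cbn [fst snd]. rewrite Rinv_1.
      replace (-1 * - ((a + b) / 2) / 1) with ((a + b) / 2) by field.
      split; intros [h1 h2]; split; lra.
    (* The center lies below the boundary line, so the sides of the geodesic are exchanged by
       inversion in it; [w2] is its squared radius. *)
    + set (w2 := (a - b) ^ 2 / 4). assert (Hw : 0 < w2) by (unfold w2; lra).
      exists (fun z => similarity 1 w2 0
               ((fun z => inversion (similarity 1 1 (- ((a + b) / 2)) z)) z)).
      split.
      { apply isometry_comp; [apply similarity_isometry; lra|].
        apply isometry_comp; [apply inversion_isometry | apply similarity_isometry; lra]. }
      intros al Hal. apply image_comp with (level w2 0 (-1) al).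
      * apply image_comp with (level (-1) 0 w2 al); [|apply image_inversion_level].
        apply image_similarity_level; [lra | lra |]. intros z.
        unfold level, halfplane, similarity, w2. cbn [fst snd]. rewrite Rinv_1.
        replace (- (1) * - ((a + b) / 2) / 1) with ((a + b) / 2) by field.
        split; intros [h1 h2]; split; lra.
      * apply image_similarity_level; [lra | lra |]. intros z.
        rewrite <- (centered_circle_level (1 / 2) al ((a - b) ^ 2) (Hn al Hal) z).
        unfold level, halfplane, similarity. cbn [fst snd].
        assert (Hi : 0 < / w2) by (apply Rinv_0_lt_compat, Hw).
        replace ((a - b) ^ 2) with (4 * w2) by (unfold w2; field). clearbody w2.
        split; intros [h1 h2].
        -- split; [apply (Rmult_lt_reg_l (/ w2)); lra|].
           apply (f_equal (fun x => w2 * x)) in h2.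
           field_simplify in h2; lra.
        -- split; [apply Rmult_lt_0_compat; assumption|].
           apply (Rmult_eq_reg_l w2); [|lra]. field_simplify; lra.
Qed.

Lemma equidistant_family_lines (a sg : R) : sg = 1 \/ sg = -1 ->
  equidistant_family (Ideal a) Ideal_infty 0 sg (- sg * a) 1.
Proof.
  intros Hsg. assert (Hs2 : sg ^ 2 = 1) by (destruct Hsg as [-> | ->]; ring).
  assert (Hs0 : sg <> 0) by lra.
  assert (Ed : discr 0 sg (- sg * a) = 1) by (rewrite <- Hs2; unfold discr; ring).
  unfold equidistant_family. rewrite Ed.
  split; [lra|]. split; [lra|]. split; [|split].
  - intros z. unfold level. split; intros [h1 h2]; (split; [exact h1|]).
    + apply (Rmult_eq_reg_l sg); [lra | exact Hs0].
    + rewrite h2. ring.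
  - intros al Hal. split.
    + exists (sg / al). split; [apply Rmult_integral_contrapositive_currified;
        [exact Hs0 | apply Rinv_neq_0_compat; lra]|].
      intros z. unfold level. split; intros [h1 h2]; (split; [exact h1|]).
      * apply (Rmult_eq_reg_l al); [|lra]. rewrite <- h2. field. lra.
      * rewrite h2. field. lra.
    + exists (a + sg * al, 1), (a + 2 * sg * al, 2).
      assert (K : forall y, 0 < y -> level 0 sg (- sg * a) al (a + y * sg * al, y)).
      { intros y Hy. split; [exact Hy|]. cbn [fst snd].
        transitivity (sg ^ 2 * al * y); [ring | rewrite Hs2; ring]. }
      split; [|split].
      * assert (K1 := K 1 ltac:(lra)). rewrite Rmult_1_l in K1. exact K1.
      * exact (K 2 ltac:(lra)).
      * intros E. injection E as _ E. lra.
  (* The successive maps send the ideal point [a] to 1/2, 2, 1 and infinity to infinity, 0, -1. The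
     reflection [- sg] puts the curves outside the resulting half-circle. *)
  - exists (fun z => similarity 1 1 (-1)
             ((fun z => inversion (similarity (- sg) 1 (sg * a + 1 / 2) z)) z)).
    split.
    { apply isometry_comp; [apply similarity_isometry; lra|].
      apply isometry_comp; [apply inversion_isometry | apply similarity_isometry; lra]. }
    intros al Hal. apply image_comp with (level (1 / 2) (-1) 0 al).
    + apply image_comp with (level 0 (-1) (1 / 2) al); [|apply image_inversion_level].
      apply image_similarity_level; [lra | lra |]. intros z.
      unfold level, halfplane, similarity. cbn [fst snd]. rewrite Rinv_1.
      replace (0 * _ + sg * _ + - sg * a) with (sg ^ 2 * (- fst z + (1 / 2)) + (sg ^ 2 - 1) * (sg * a))
        by field.
      rewrite Hs2. split; intros [h1 h2]; split; lra.
    + apply image_similarity_level; [lra | lra |]. intros z.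
      rewrite <- (centered_circle_level 1 al 1 ltac:(nra) z).
      unfold level, halfplane, similarity. cbn [fst snd]. rewrite Rinv_1.
      replace (-1 * -1 / 1) with 1 by field.
      replace (- (1) * -1 / 1) with 1 by field.
      split; intros [h1 h2]; split; lra.
Qed.

(** The sign of the height of the center, or of the slope, is moved into the coefficients, which
    makes the level value positive. *)
Lemma equidistant_is_level (z1 z2 : ideal_point) (S : pset) :
  is_equidistant_line z1 z2 S ->
  exists A B D s a0, equidistant_family z1 z2 A B D s /\ 0 < a0 /\ same_set S (level A B D a0).
Proof.
  assert (Hsg : forall k, k <> 0 -> exists sg, (sg = 1 \/ sg = -1) /\ k = sg * Rabs k).
  { intros k Hk. unfold Rabs. destruct (Rcase_abs k); [exists (-1) | exists 1]; split; auto; ring. }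
  assert (L : forall a k, k <> 0 -> same_set S (fun p => halfplane p /\ snd p = k * (fst p - a)) ->
    exists sg, (sg = 1 \/ sg = -1) /\ same_set S (level 0 sg (- sg * a) (/ Rabs k))).
  { intros a k Hk HS. destruct (Hsg k Hk) as [sg [H1 H2]]. exists sg. split; [exact H1|].
    assert (Hp := Rabs_pos_lt k Hk).
    apply (same_set_trans _ _ _ HS), (same_set_level _ _ _ _ (- Rabs k)); [lra|].
    intros z. rewrite H2 at 1.
    replace (- Rabs k * _) with (snd z - sg * Rabs k * (fst z - a)) by (field; lra).
    split; intros H; lra. }
  assert (Hinv : forall k, k <> 0 -> 0 < / Rabs k)
    by (intros k Hk; apply Rinv_0_lt_compat, Rabs_pos_lt, Hk).
  destruct z1 as [a|], z2 as [b|]; simpl.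
  - intros [Hab (m & c & rho & Hc & Ha & Hb & HS)]. destruct (Hsg c Hc) as [sg [H1 H2]].
    unfold ecircle in Ha, Hb. cbn [fst snd] in Ha, Hb.
    assert (Em : 2 * m = a + b).
    { apply (Rmult_eq_reg_l (a - b)); [|lra]. lra. }
    assert (Er : m ^ 2 + c ^ 2 - rho ^ 2 = a * b).
    { rewrite <- Ha. replace b with (2 * m - a) by lra. ring. }
    assert (Hs2 : sg ^ 2 = 1) by (destruct H1 as [-> | ->]; ring).
    exists sg, (- sg * (a + b)), (sg * (a * b)), (1 / 2), (2 * Rabs c).
    split; [apply equidistant_family_arcs; assumption|].
    split; [assert (h := Rabs_pos_lt c Hc); lra|].
    apply (same_set_trans _ _ _ HS), (same_set_level _ _ _ _ sg); [lra|].
    intros z. unfold ecircle. cbn [fst snd].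
    assert (E : sg * (sg * (fst z ^ 2 + snd z ^ 2) + - sg * (a + b) * fst z + sg * (a * b)
                      - 2 * Rabs c * snd z)
      = sg ^ 2 * (fst z ^ 2 + snd z ^ 2 - (a + b) * fst z + a * b) - 2 * (sg * Rabs c) * snd z)
      by ring.
    rewrite E, Hs2, <- H2, <- Em, <- Er. split; intros H; lra.
  - intros [k [Hk HS]]. destruct (L a k Hk HS) as [sg [H1 H2]].
    exists 0, sg, (- sg * a), 1, (/ Rabs k).
    split; [apply equidistant_family_lines; assumption|]. split; [auto | exact H2].
  - intros [k [Hk HS]]. destruct (L b k Hk HS) as [sg [H1 H2]].
    exists 0, sg, (- sg * b), 1, (/ Rabs k).
    split; [exact (equidistant_family_lines b sg H1)|]. split; [auto | exact H2].
  - intros [].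
Qed.

(** Sliding between the level and the geodesic moves every point by the same distance, whose
    hyperbolic cosine is [r]. *)
Lemma level_near_geodesic (A B D al eps : R) : 0 < discr A B D -> 0 < al -> 0 < eps ->
  al ^ 2 < 4 * discr A B D * sinh (eps / 2) ^ 2 ->
  (forall p, level A B D al p -> exists q, level A B D 0 q /\ hdist p q < eps) /\
  (forall q, level A B D 0 q -> exists p, level A B D al p /\ hdist p q < eps).
Proof.
  intros Hd Hal He Hlt. set (dl := discr A B D) in *.
  set (r := sqrt (1 + al ^ 2 / dl)).
  assert (Hu : 0 < al ^ 2 / dl) by (apply Rdiv_lt_0_compat; [apply pow_lt|]; assumption).
  assert (Hr2 : r ^ 2 = 1 + al ^ 2 / dl) by (apply pow2_sqrt; lra).
  assert (Hr1 : 1 <= r) by (rewrite <- sqrt_1; apply sqrt_le_1_alt; lra).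
  (* [(r - 1) / 2] is [sinh (d / 2) ^ 2] for the displacement [d]; the inequality
     [sqrt (1 + u) <= 1 + u / 2] bounds it by [al ^ 2 / (4 dl)]. *)
  assert (Hb : (r - 1) / 2 < sinh (eps / 2) ^ 2).
  { apply Rle_lt_trans with (al ^ 2 / dl / 4); [nra|].
    apply (Rmult_lt_reg_r (4 * dl)); [lra|]. field_simplify; lra. }
  assert (S2 : slidable A B D 0 al r).
  { repeat split; try lra. rewrite Hr2. fold dl. field. lra. }
  assert (S1 := slidable_inv _ _ _ _ _ _ S2).
  assert (Hhp : forall al' z, level A B D al' z -> halfplane z) by (intros al' z Hz; apply Hz).
  split.
  - intros p Hp. exists (slide A B al 0 (/ r) p).
    assert (Hq := slide_level A B D al 0 (/ r) S1 p Hp). split; [exact Hq|].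
    apply hdist_lt with ((r - 1) / 2); try assumption; [eauto | eauto | lra |].
    unfold sqdist. rewrite (slide_dist A B D al 0 (/ r) S1 p Hp). field. lra.
  - intros q Hq. exists (slide A B 0 al r q).
    assert (Hp := slide_level A B D 0 al r S2 q Hq). split; [exact Hp|]. rewrite hdist_sym.
    apply hdist_lt with ((r - 1) / 2); try assumption; [eauto | eauto | lra |].
    unfold sqdist. rewrite (slide_dist A B D 0 al r S2 q Hq). field. lra.
Qed.

Lemma equidistant_case (I : R -> Prop) (c : R -> plane) (kappa : R) (z1 z2 : ideal_point) :
  is_interval I -> 0 < kappa -> has_constant_curvature I c kappa ->
  is_equidistant_line z1 z2 (trace I c) ->
  exists (T : Rbar) (g : R -> R -> plane),
    is_the_ICSF I (after T) c g /\
    (forall t, after T t -> is_equidistant_line z1 z2 (trace I (g t))) /\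
    expanding normalized_equidistant_line (after T) (fun t => trace I (g t)) /\
    exists G : pset, is_geodesic z1 z2 G /\
      converges_to (backward T) (fun t => trace I (g t)) G.
Proof.
  intros HI Hk Hcc Hz.
  destruct (equidistant_is_level z1 z2 _ Hz) as (A & B & D & s & a0 & Hfam & Ha0 & HS).
  destruct Hfam as (Hd & Hs & Hgeo & Hlev & f & Hf & Himg).
  destruct (proj2 (Hlev a0 Ha0)) as (p & q & Hp & Hq & Hpq).
  assert (HW : 0 < a0 ^ 2 + discr A B D) by nra.
  (* The time at which [alpha] would reach 0, the value on the geodesic. *)
  set (T := ln (discr A B D / (a0 ^ 2 + discr A B D)) / 2).
  assert (HT : forall t, after T t <-> flow_time a0 (discr A B D) t)
    by (intros t; apply flow_time_pos, Hd).
  destruct (level_flow A B D a0 kappa I c T p q HI Hk Hcc Ha0 HW HS Hp Hq Hpq HT)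
    as (g & Hg & _ & Htr).
  set (dl := discr A B D) in *.
  assert (Hal : forall t, after T t -> 0 < alpha a0 dl t)
    by (intros t Ht; apply alpha_pos, HT, Ht).
  assert (Has : forall t, after T t -> alpha a0 dl t ^ 2 + dl = (a0 ^ 2 + dl) * exp t ^ 2)
    by (intros t Ht; rewrite alpha_sqr by (apply HT, Ht); ring).
  assert (HW' := sqrt_lt_R0 _ HW).
  assert (Hrho : forall t, after T t ->
    sqrt (alpha a0 dl t ^ 2 + dl) = sqrt (a0 ^ 2 + dl) * exp t).
  { intros t Ht.
    rewrite Has, sqrt_mult_alt, sqrt_pow2 by (assumption || lra || (left; apply exp_pos)).
    reflexivity. }
  exists T, g. split; [exact Hg|]. split; [|split].
  - intros t Ht. destruct (Hlev _ (Hal t Ht)) as [H _].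
    assert (Hsame := Htr t Ht).
    clear - H Hsame. destruct z1 as [a|], z2 as [b|]; simpl in *.
    + destruct H as [Hab (m & cc & rho & H1 & H2 & H3 & H4)]. split; [exact Hab|].
      exists m, cc, rho. repeat (split; [assumption|]). apply (same_set_trans _ _ _ Hsame H4).
    + destruct H as [k [H1 H2]]. exists k. split; [exact H1 | exact (same_set_trans _ _ _ Hsame H2)].
    + destruct H as [k [H1 H2]]. exists k. split; [exact H1 | exact (same_set_trans _ _ _ Hsame H2)].
    + exact H.
  - exists f. split; [exact Hf|]. exists (fun t => s * (sqrt (a0 ^ 2 + dl) * exp t)).
    split; [|split].
    + intros t Ht. assert (Ht' := Hal t Ht). exists (s * alpha a0 dl t). split.
      * split; [apply Rmult_lt_0_compat; assumption|].
        apply Rmult_lt_compat_l; [exact Hs|]. rewrite <- Hrho by exact Ht.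
        rewrite <- (sqrt_pow2 (alpha a0 dl t)) at 1 by lra. apply sqrt_lt_1_alt.
        split; [apply pow2_ge_0 | lra].
      * rewrite <- Hrho by exact Ht.
        exact (same_set_trans _ _ _ (image_same _ _ _ (Htr t Ht)) (Himg _ Ht')).
    + intros t1 t2 _ _ Ht. apply Rmult_lt_compat_l; [exact Hs|].
      apply Rmult_lt_compat_l; [exact HW' | apply exp_increasing, Ht].
    + apply is_lim_p_infty_intro. intros M. exists (M / (s * sqrt (a0 ^ 2 + dl))). intros t Ht.
      assert (h := exp_ineq1_le t).
      assert (Hss : 0 < s * sqrt (a0 ^ 2 + dl)) by (apply Rmult_lt_0_compat; assumption).
      apply (Rmult_lt_compat_l _ _ _ Hss) in Ht.
      replace (s * sqrt (a0 ^ 2 + dl) * (M / (s * sqrt (a0 ^ 2 + dl)))) with M in Ht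
        by (field; lra).
      apply (Rmult_le_compat_l _ _ _ (Rlt_le _ _ Hss)) in h. lra.
  - exists (level A B D 0). split; [exact Hgeo|]. intros eps He.
    assert (Hsh : 0 < sinh (eps / 2) ^ 2)
      by (apply pow_lt; rewrite <- sinh_0; apply sinh_lt; lra).
    (* The value of [al ^ 2 + dl] at which the bound in [level_near_geodesic] becomes an
       equality. *)
    set (eta := dl + 4 * dl * sinh (eps / 2) ^ 2).
    assert (Hprod : 0 < dl * sinh (eps / 2) ^ 2) by (apply Rmult_lt_0_compat; assumption).
    assert (HX : 0 < ln (eta / (a0 ^ 2 + dl)) / 2 - T).
    { assert (T < ln (eta / (a0 ^ 2 + dl)) / 2); [|lra]. unfold T.
      apply lt_exp_double; [exact HW | exact Hd |].
      rewrite exp_double_ln; unfold eta; lra. }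
    exists (mkposreal _ HX). intros t Hball _ Ht.
    assert (Htt : t < ln (eta / (a0 ^ 2 + dl)) / 2).
    { assert (h : Rabs (t - T) < ln (eta / (a0 ^ 2 + dl)) / 2 - T) by exact Hball.
      assert (h' := Rle_abs (t - T)). lra. }
    apply exp_double_lt in Htt; [|exact HW | unfold eta; lra].
    assert (Ht' := Has t Ht). rewrite exp_double in Htt.
    destruct (level_near_geodesic A B D (alpha a0 dl t) eps) as [N1 N2]; auto.
    { fold dl. unfold eta in Htt. lra. }
    split.
    + intros x Hx. apply N1, (Htr t Ht), Hx.
    + intros x Hx. destruct (N2 x Hx) as [y [Hy1 Hy2]]. exists y. split; [|exact Hy2].
      apply (Htr t Ht), Hy1.
Qed.

Theorem proposition3p4 (I : R -> Prop) (c : R -> plane) (kappa : R)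
  (hI : is_interval I) (hkappa : 0 < kappa)
  (hc : has_constant_curvature I c kappa) :
  (forall p : plane, halfplane p -> is_hyperbolic_circle p (trace I c) ->
     exists (T : Rbar) (g : R -> R -> plane),
       is_the_ICSF I (after T) c g /\
       (forall t, after T t -> is_hyperbolic_circle p (trace I (g t))) /\
       expanding normalized_circle (after T) (fun t => trace I (g t)) /\
       converges_to (backward T) (fun t => trace I (g t)) (fun q => q = p))
  /\
  (forall z : ideal_point, is_horocycle z (trace I c) ->
     exists (T : Rbar) (g : R -> R -> plane),
       is_the_ICSF I (after T) c g /\
       (forall t, after T t -> is_horocycle z (trace I (g t))) /\
       expanding normalized_horocycle (after T) (fun t => trace I (g t)) /\
       converges_to_ideal (backward T) (fun t => trace I (g t)) z)
  /\
  (forall z1 z2 : ideal_point, is_equidistant_line z1 z2 (trace I c) ->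
     exists (T : Rbar) (g : R -> R -> plane),
       is_the_ICSF I (after T) c g /\
       (forall t, after T t -> is_equidistant_line z1 z2 (trace I (g t))) /\
       expanding normalized_equidistant_line (after T)
         (fun t => trace I (g t)) /\
       exists G : pset, is_geodesic z1 z2 G /\
         converges_to (backward T) (fun t => trace I (g t)) G).
Proof.
  split; [|split].
  - intros p Hp Hc. exact (circle_case I c kappa p hI hkappa hc Hp Hc).
  - intros z Hz. exact (horocycle_case I c kappa z hI hkappa hc Hz).
  - intros z1 z2 Hz. exact (equidistant_case I c kappa z1 z2 hI hkappa hc Hz).
Qed.
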